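(* The following relations between local moves hold: $\mathrm{CC}\stackrel{w}{\Rightarrow}\mathrm{BP}\stackrel{w}{\Rightarrow}\Delta\stackrel{w}{\Rightarrow}\mathrm{SC}$.
   Context: $M_2\stackrel{w}{\Rightarrow}M_1$ (''$M_2$ w-generates $M_1$'') means that $M_1$ can be realized using $M_2$ and welded Reidemeister moves: for every $n\ge1$, any two Gauss diagrams on $n$ strands differing by one $M_1$ move are related by a finite sequence of $M_2$ and welded Reidemeister moves. A Gauss diagram on $n$ strands is a finite set of signed arrows (tail, head, sign $\pm1$), all endpoints being distinct points of $n$ ordered oriented intervals (strands), up to orientation-preserving homeomorphisms of the intervals. Endpoints are adjacent if they lie on the same strand with no other endpoint between them; a self-arrow has both ends on the same strand. Moves are used in both directions; portions of strands below are disjoint, contain only the mentioned endpoints, and may lie on any strands (possibly the same) with any orientation. Welded Reidemeister moves: (R1) insert or delete an arrow of any sign with adjacent endpoints; (R2) insert or delete two arrows with opposite signs whose tails are adjacent on one portion and whose heads are adjacent on another; (R3) given portions $s_1,s_2,s_3$ containing exactly the endpoints of arrows $s_1\to s_2$, $s_2\to s_3$, $s_1\to s_3$ with signs $\varepsilon_{12},\varepsilon_{23},\varepsilon_{13}$, exchange the two endpoints on each portion, provided $\varepsilon_{12}\eta_1\eta_2=\varepsilon_{23}\eta_2\eta_3=-\varepsilon_{13}\eta_1\eta_3$, where $\eta_k=+1$ if along the orientation the endpoint on $s_k$ of the arrow joining $s_k$ and $s_{k-1}$ precedes that of the arrow joining $s_k$ and $s_{k+1}$ (indices mod 3), and $-1$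 otherwise; (OC) exchange two adjacent tails. Local moves. $\mathrm{CC}$ (crossing change): reverse the direction and change the sign of an arrow. $\mathrm{SC}$: the same, for a self-arrow. $\Delta$: given portions $s_1,s_2,s_3$ containing exactly the endpoints of arrows $s_1\to s_2$, $s_2\to s_3$, $s_3\to s_1$ with signs $\varepsilon_{12},\varepsilon_{23},\varepsilon_{31}$, exchange the two endpoints on each portion, provided $\varepsilon_{12}\eta_1\eta_2=\varepsilon_{23}\eta_2\eta_3=\varepsilon_{31}\eta_3\eta_1$, with $\eta_k$ as in R3. $\mathrm{BP}$ (unoriented band-pass): given portions $s_1,\dots,s_4$ containing exactly the endpoints of four arrows, one from $s_i$ to $s_j$ with sign $\varepsilon_{ij}$ for each $i\in\{1,2\}$, $j\in\{3,4\}$, reverse direction and change sign of all four, provided $\varepsilon_{ij}\eta_i\eta_j$ is the same for all four pairs, where $\eta_i=+1$ ($i\in\{1,2\}$) if the endpoint on $s_i$ of the arrow to $s_3$ precedes that of the arrow to $s_4$, $\eta_j=+1$ ($j\in\{3,4\}$) if the endpoint on $s_j$ of the arrow from $s_1$ precedes that of the arrow from $s_2$, and $-1$ otherwise. *)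

(* Defs.v *)
From mathcomp Require Import all_boot all_order all_algebra.
From Stdlib Require Export Relation_Operators.

Set Implicit Arguments.
Unset Strict Implicit.
Unset Printing Implicit Defensive.

Import GRing.Theory.

(* Arrows are labelled by natural numbers.  Strands being considered up to
   orientation-preserving homeomorphism, each is the word of its endpoints
   read along its orientation; relabellings of arrows are dealt with by
   [diagram_iso]. *)
Definition endpoint : Type := (nat * bool)%type.
Definition tail_of (a : nat) : endpoint := (a, false).
Definition head_of (a : nat) : endpoint := (a, true).

(* [true] stands for +1, both for the signs of arrows and for the [eta]s. *)
Definition pm1 (b : bool) : int := if b then 1%R else (-1)%R.

(* Only the values of [sgn] at labels occurring in the diagram matter. *)
Record gauss_diagram (n : nat) := GaussDiagram {
  strand : 'I_n -> seq endpoint;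
  sgn : nat -> bool;
  endpoints_uniq : uniq (flatten [seq strand k | k <- enum 'I_n]);
  tail_head : forall a : nat,
    (tail_of a \in flatten [seq strand k | k <- enum 'I_n]) =
    (head_of a \in flatten [seq strand k | k <- enum 'I_n])
}.

Section Diagrams.
Variable n : nat.
Implicit Types (D E : gauss_diagram n) (x y e : endpoint) (a b : nat).

Definition endpoints D : seq endpoint :=
  flatten [seq strand D k | k <- enum 'I_n].

Definition arrows D : pred nat := [pred a | tail_of a \in endpoints D].

Definition eps D a : int := pm1 (sgn D a).

Definition diagram_iso D E : Prop :=
  exists f : nat -> nat,
    [/\ {in arrows D &, injective f},
        forall k, strand E k = [seq (f e.1, e.2) | e <- strand D k]
      & {in arrows D, forall a, sgn E (f a) = sgn D a}].

(* [x] immediately precedes [y] on some strand. *)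
Definition precedes D x y : bool := [exists k, infix [:: x; y] (strand D k)].

Definition adjacent D x y : bool := precedes D x y || precedes D y x.

(* Only used when [x] and [y] are adjacent, i.e. are exactly the endpoints
   lying on some portion of strand; portions with distinct endpoints can be
   chosen disjoint. *)
Definition eta D x y : int := pm1 (precedes D x y).

Definition swap x y : endpoint -> endpoint :=
  [fun e => e with x |-> y, y |-> x].

Definition swaps (s : seq (endpoint * endpoint)) e : endpoint :=
  foldr (fun p => swap p.1 p.2) e s.

Definition exchange (s : seq (endpoint * endpoint)) D E : Prop :=
  (forall k, strand E k = [seq swaps s e | e <- strand D k]) /\
  {in arrows D, sgn E =1 sgn D}.

Definition delete (s : seq nat) D E : Prop :=
  (forall k, strand E k = [seq e <- strand D k | e.1 \notin s]) /\
  {in arrows E, sgn E =1 sgn D}.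

(* Reverses the direction and changes the sign of the arrows in [s]. *)
Definition reverse (s : seq nat) D E : Prop :=
  (forall k, strand E k =
     [seq (e.1, if e.1 \in s then ~~ e.2 else e.2) | e <- strand D k]) /\
  {in arrows D, forall a, sgn E a = if a \in s then ~~ sgn D a else sgn D a}.

End Diagrams.

Definition local_move : Type :=
  forall n : nat, gauss_diagram n -> gauss_diagram n -> Prop.

(* Moves are given in one direction and on representatives; see [one_move]. *)

Definition R1 : local_move := fun n D E =>
  exists a : nat, adjacent D (tail_of a) (head_of a) /\ delete [:: a] D E.

Definition R2 : local_move := fun n D E =>
  exists a b : nat,
    [/\ sgn D a = ~~ sgn D b,
        adjacent D (tail_of a) (tail_of b),
        adjacent D (head_of a) (head_of b)
      & delete [:: a; b] D E].

Definition R3 : local_move := fun n D E =>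
  exists a12 a23 a13 : nat,
    let eta1 := eta D (tail_of a13) (tail_of a12) in
    let eta2 := eta D (head_of a12) (tail_of a23) in
    let eta3 := eta D (head_of a23) (head_of a13) in
    [/\ uniq [:: a12; a23; a13],
        [/\ adjacent D (tail_of a13) (tail_of a12),
            adjacent D (head_of a12) (tail_of a23)
          & adjacent D (head_of a23) (head_of a13)],
        (eps D a12 * eta1 * eta2 = eps D a23 * eta2 * eta3)%R,
        (eps D a23 * eta2 * eta3 = - (eps D a13 * eta1 * eta3))%R
      & exchange [:: (tail_of a13, tail_of a12); (head_of a12, tail_of a23);
                     (head_of a23, head_of a13)] D E].

Definition OC : local_move := fun n D E =>
  exists a b : nat,
    adjacent D (tail_of a) (tail_of b) /\ exchange [:: (tail_of a, tail_of b)] D E.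

Definition welded : local_move := fun n D E =>
  [\/ R1 D E, R2 D E, R3 D E | OC D E].

Definition CC : local_move := fun n D E =>
  exists a : nat, a \in arrows D /\ reverse [:: a] D E.

Definition SC : local_move := fun n D E =>
  exists a : nat,
    (exists k, tail_of a \in strand D k /\ head_of a \in strand D k) /\
    reverse [:: a] D E.

Definition Delta : local_move := fun n D E =>
  exists a12 a23 a31 : nat,
    let eta1 := eta D (head_of a31) (tail_of a12) in
    let eta2 := eta D (head_of a12) (tail_of a23) in
    let eta3 := eta D (head_of a23) (tail_of a31) in
    [/\ uniq [:: a12; a23; a31],
        [/\ adjacent D (head_of a31) (tail_of a12),
            adjacent D (head_of a12) (tail_of a23)
          & adjacent D (head_of a23) (tail_of a31)],
        (eps D a12 * eta1 * eta2 = eps D a23 * eta2 * eta3)%R,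
        (eps D a23 * eta2 * eta3 = eps D a31 * eta3 * eta1)%R
      & exchange [:: (head_of a31, tail_of a12); (head_of a12, tail_of a23);
                     (head_of a23, tail_of a31)] D E].

Definition BP : local_move := fun n D E =>
  exists a13 a14 a23 a24 : nat,
    let eta1 := eta D (tail_of a13) (tail_of a14) in
    let eta2 := eta D (tail_of a23) (tail_of a24) in
    let eta3 := eta D (head_of a13) (head_of a23) in
    let eta4 := eta D (head_of a14) (head_of a24) in
    [/\ uniq [:: a13; a14; a23; a24],
        [/\ adjacent D (tail_of a13) (tail_of a14),
            adjacent D (tail_of a23) (tail_of a24),
            adjacent D (head_of a13) (head_of a23)
          & adjacent D (head_of a14) (head_of a24)],
        [/\ (eps D a13 * eta1 * eta3 = eps D a14 * eta1 * eta4)%R,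
            (eps D a14 * eta1 * eta4 = eps D a23 * eta2 * eta3)%R
          & (eps D a23 * eta2 * eta3 = eps D a24 * eta2 * eta4)%R]
      & reverse [:: a13; a14; a23; a24] D E].

(* The diagrams differ, up to isomorphism, by one move in either direction. *)
Definition one_move (M : local_move) (n : nat) (D D' : gauss_diagram n) :
    Prop :=
  exists E E' : gauss_diagram n,
    [/\ diagram_iso D E, diagram_iso D' E' & M n E E' \/ M n E' E].

Definition w_related (M : local_move) (n : nat) :
    gauss_diagram n -> gauss_diagram n -> Prop :=
  clos_refl_trans (gauss_diagram n) (fun D D' =>
    [\/ diagram_iso D D', one_move M D D' | one_move welded D D']).

Definition w_generates (M2 M1 : local_move) : Prop :=
  forall n : nat, (0 < n)%N ->
  forall D D' : gauss_diagram n, one_move M1 D D' -> w_related M2 D D'.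

(* Main.v *)
Require Import Defs.
From mathcomp Require Import all_boot all_order all_algebra.
From mathcomp Require Import zify.

Set Implicit Arguments.
Unset Strict Implicit.
Unset Printing Implicit Defensive.

(** Every step is a relation between diagrams, up to relabelling, so it is enough to connect
    by allowed moves the two sides of one move on representatives.

    [CC] realizes [BP] by reversing the four arrows of the band-pass one after the other.

    [BP] realizes far more than [Delta]: it realizes the exchange of any adjacent head and
    tail of two distinct arrows, with no condition on signs ([w_equiv_BP_exchange]), and
    [Delta] is three such exchanges.  The reason is that a band-pass can turn an adjacent
    head of an arrow into a tail.  Take [H_o T_d] on a strand.  An R2 move adds arrows [p]
    and [q] parallel to [o], giving [H_o T_d H_p H_q], and R1 and OC moves add two
    self-arrows [i] and [j], giving [H_o H_i T_i T_j T_d H_j H_p H_q].  The portions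
    [H_o H_i], [T_i T_j], [H_j H_p] and [T_o T_p] are those of a band-pass, which leads to
    [T_o T_i H_i H_j T_d T_j T_p H_q].  Now [i] is a curl, [j] becomes one after a tail
    exchange, and the tails of [d], [o] and [p] commute; so [o] and [p] cancel and
    [T_d H_q] remains, where [q] is a copy of [o].

    For [Delta] and [SC], let [P] and [Q] be the two ends of a self-arrow [a], in the order
    of the strand.  If only tails separate them, then, whichever of the two is the head,
    tail exchanges make them adjacent and R1 deletes [a]; so the diagram and the one with [a]
    reversed are both equivalent to the diagram without [a] ([w_equiv_remove_loop]).  In
    general, [P] is pushed along the loop towards [Q], simultaneously in both diagrams and
    with the same result up to the direction of [a].  To pass an end [x] of an arrow [b], two
    opposite arrows are inserted by R2 between [Q] and the other end of [b], and one of them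
    forms with [a] and [b] a triangle to which R3 or [Delta] applies ([w_equiv_slide]).  Which
    of the two applies depends on the directions of the three arrows, but the sign
    condition does not change when an arrow is reversed and its sign changed
    ([w_equiv_triangle]), so the same insertion serves both diagrams.

    The inserted arrows can be given their tails near [Q], so that they only add tails in
    front of [Q].  They may however add heads elsewhere in the loop, next to the other end of
    [b].  A head of an inserted arrow whose tail waits in front of [Q] can be passed at no
    cost: then the new arrows are given their heads near [Q] and tail exchanges turn one of
    them into a curl ([w_equiv_drop_curl]).  Thus an arrow with both ends still to be passed
    is replaced by three ends to pass, none of which has its other end among those to pass,
    and the number of ends to pass plus the number of those whose other end is also to be
    passed decreases ([loop_measure_slide]). *)

(** * Diagrams as strands and signs *)

Section RawDiagrams.
Variable n : nat.
Implicit Types (s : 'I_n -> seq endpoint) (g : nat -> bool) (e x y z : endpoint).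

Definition ends s : seq endpoint := flatten [seq s k | k <- enum 'I_n].

Definition wf s : Prop :=
  uniq (ends s) /\ forall a, (tail_of a \in ends s) = (head_of a \in ends s).

Definition diagram_of s g (h : wf s) : gauss_diagram n := GaussDiagram g h.1 h.2.

Definition prec s x y : bool := [exists k, infix [:: x; y] (s k)].
Definition adj s x y : bool := prec s x y || prec s y x.

Lemma mem_ends s k e : e \in s k -> e \in ends s.
Proof. by move=> he; apply/flatten_mapP; exists k; rewrite ?mem_enum. Qed.

Lemma endsP s e : reflect (exists k, e \in s k) (e \in ends s).
Proof.
apply: (iffP flatten_mapP) => [[k _ he]|[k he]]; exists k => //.
by rewrite mem_enum.
Qed.

Lemma eq_ends s s' : s =1 s' -> ends s = ends s'.
Proof. by move=> es; rewrite /ends (eq_map es). Qed.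

Lemma wf_perm s s' : perm_eq (ends s) (ends s') -> wf s -> wf s'.
Proof.
move=> p [u b]; split; first by rewrite -(perm_uniq p).
by move=> a; rewrite -!(perm_mem p).
Qed.

Lemma wf_eq s s' : s =1 s' -> wf s -> wf s'.
Proof. by move=> es; apply: wf_perm; rewrite (eq_ends es). Qed.

Lemma uniq_flatten_map (T : eqType) (ks : seq T) (f : T -> seq endpoint) k :
  uniq (flatten (map f ks)) -> k \in ks -> uniq (f k).
Proof.
elim: ks => //= j ks IH; rewrite cat_uniq inE => /and3P [uj _ uks].
by case/orP => [/eqP-> //|/(IH uks)].
Qed.

Lemma wf_uniq s k : wf s -> uniq (s k).
Proof. by case=> u _; apply: uniq_flatten_map u _; rewrite mem_enum. Qed.

Lemma flatten_map_disjoint (T : eqType) (ks : seq T) (f : T -> seq endpoint) j k e :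
  uniq ks -> uniq (flatten (map f ks)) -> j \in ks -> k \in ks ->
  e \in f j -> e \in f k -> j = k.
Proof.
move=> + + + + ej ek; elim: ks => //= i ks IH /andP [ni uks].
rewrite cat_uniq !inE => /and3P [_ /hasPn h u].
have abs l : l \in ks -> e \in f l -> e \in f i -> False.
  move=> lks el ei; have /h : e \in flatten (map f ks) by apply/flatten_mapP; exists l.
  by rewrite /= ei.
case/orP=> [/eqP ?|jk]; case/orP=> [/eqP ?|kk]; subst => //.
- by case: (abs k).
- by case: (abs j).
- exact: IH.
Qed.

Lemma wf_strand s j k e : wf s -> e \in s j -> e \in s k -> j = k.
Proof.
case=> u _; apply: flatten_map_disjoint u _ _; rewrite ?enum_uniq ?mem_enum //.
Qed.

Definition same_signs s g g' := forall a, tail_of a \in ends s -> g a = g' a.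

Definition raw_diagram : Type := (('I_n -> seq endpoint) * (nat -> bool))%type.

(** Well-formedness of both sides is part of the relation: along a chain of moves it is
    inherited, and has to be checked for a single diagram only. *)
Definition w_equiv (M : local_move) (p q : raw_diagram) : Prop :=
  exists (hp : wf p.1) (hq : wf q.1),
    w_related M (diagram_of p.2 hp) (diagram_of q.2 hq).

Lemma diagram_iso_ext (D E : gauss_diagram n) :
  (forall k, strand E k = strand D k) -> {in arrows D, sgn E =1 sgn D} -> diagram_iso D E.
Proof.
move=> es eg; exists id; split => //.
by move=> k; rewrite es -[LHS]map_id; apply: eq_map; case.
Qed.

Lemma arrowsP (D : gauss_diagram n) e : e \in endpoints D -> e.1 \in arrows D.
Proof. by case: e => a []; rewrite inE //= (tail_head D a). Qed.

(** The relabelling is injective only on the labels that occur, so its inverse is read off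
    from the list of these labels. *)
Lemma diagram_iso_sym (D E : gauss_diagram n) : diagram_iso D E -> diagram_iso E D.
Proof.
case=> f [fi fs fg].
pose L := [seq e.1 | e <- endpoints D].
have arrL a : (a \in L) = (a \in arrows D).
  apply/mapP/idP => [[e he ->]|]; first exact: arrowsP.
  by move=> ha; exists (tail_of a).
have fiL : {in L &, injective f} by move=> a b; rewrite !arrL; apply: fi.
pose h b := nth 0 L (index b (map f L)).
have hK a : a \in arrows D -> h (f a) = a.
  by move=> ha; apply: nth_index_map; rewrite ?arrL.
have arrE b : b \in arrows E -> exists2 a, a \in arrows D & b = f a.
  rewrite inE => /endsP [k]; rewrite fs => /mapP [e he [-> _]].
  by exists e.1 => //; apply: arrowsP; apply/endsP; exists k.
exists h; split.
- move=> b c /arrE [a ha ->] /arrE [d hd ->].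
  by rewrite !hK // => ->.
- move=> k; rewrite fs -map_comp -[LHS]map_id; apply/eq_in_map => -[a b] he /=.
  by rewrite hK //; apply: (@arrowsP D (a, b)); apply/endsP; exists k.
- by move=> b /arrE [a ha ->]; rewrite hK // fg.
Qed.

Variable M : local_move.

Lemma w_related_sym (D E : gauss_diagram n) : w_related M D E -> w_related M E D.
Proof.
have sym M' D' E' : @one_move M' n D' E' -> one_move M' E' D'.
  by case=> [F [F' [h h' h2]]]; exists F', F; split=> //; case: h2; [right|left].
elim=> {D E} [D E h|D|D E F _ h _ h'].
- apply: rt_step; case: h => [/diagram_iso_sym h|/sym h|/sym h];
  by [constructor 1|constructor 2|constructor 3].
- exact: rt_refl.
- exact: rt_trans h' h.
Qed.

Lemma w_equiv_ext s s' g g' : wf s -> s =1 s' -> same_signs s g g' ->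
  w_equiv M (s, g) (s', g').
Proof.
move=> hs es eg; have hs' := wf_eq es hs; exists hs, hs'.
apply: rt_step; constructor 1; apply: diagram_iso_ext => //= a ha.
by rewrite eg.
Qed.

Lemma w_equiv_refl p : wf p.1 -> w_equiv M p p.
Proof. by case: p => s g h; apply: w_equiv_ext. Qed.

Lemma w_equiv_sym p q : w_equiv M p q -> w_equiv M q p.
Proof. by case=> hp [hq h]; exists hq, hp; apply: w_related_sym. Qed.

Lemma w_equiv_trans p q r : w_equiv M p q -> w_equiv M q r -> w_equiv M p r.
Proof.
case=> hp [hq h] [hq' [hr h']]; exists hp, hr.
apply: rt_trans h (rt_trans _ _ _ _ _ _ h').
by apply: rt_step; constructor 1; apply: diagram_iso_ext.
Qed.

Lemma w_equiv_wfl p q : w_equiv M p q -> wf p.1. Proof. by case. Qed.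
Lemma w_equiv_wfr p q : w_equiv M p q -> wf q.1. Proof. by case=> ? []. Qed.

Lemma w_equiv_step s g s' g' (h : wf s) (h' : wf s') :
  M (diagram_of g h) (diagram_of g' h') \/ welded (diagram_of g h) (diagram_of g' h') ->
  w_equiv M (s, g) (s', g').
Proof.
move=> m; exists h, h'; apply: rt_step.
have iso D : @diagram_iso n D D by apply: diagram_iso_ext.
by case: m => m; [apply: Or32|apply: Or33];
   exists (diagram_of g h), (diagram_of g' h'); split=> //; left.
Qed.

Definition erase (A : seq nat) s : 'I_n -> seq endpoint :=
  fun k => [seq e <- s k | e.1 \notin A].
Definition relabel (f : endpoint -> endpoint) s : 'I_n -> seq endpoint :=
  fun k => map f (s k).
Definition flip (A : seq nat) e : endpoint := (e.1, if e.1 \in A then ~~ e.2 else e.2).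
Definition toggle (A : seq nat) g : nat -> bool :=
  fun a => if a \in A then ~~ g a else g a.

Lemma ends_erase A s : ends (erase A s) = [seq e <- ends s | e.1 \notin A].
Proof. by rewrite [RHS]filter_flatten -[in RHS]map_comp. Qed.

Lemma ends_relabel f s : ends (relabel f s) = map f (ends s).
Proof. by rewrite [RHS]map_flatten -[in RHS]map_comp. Qed.

Lemma wf_erase A s : wf s -> wf (erase A s).
Proof.
case=> u b; split; first by rewrite ends_erase filter_uniq.
by move=> a; rewrite ends_erase !mem_filter b.
Qed.

Lemma flipK A : involutive (flip A).
Proof. by case=> a b; rewrite /flip /=; case: (a \in A) => /=; rewrite ?negbK. Qed.

Lemma wf_flip A s : wf s -> wf (relabel (flip A) s).
Proof.
case=> u b; split; first by rewrite ends_relabel map_inj_uniq //; apply: can_inj (flipK A).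
move=> a; rewrite ends_relabel -[tail_of a](flipK A) -[head_of a](flipK A).
rewrite !mem_map; try exact: can_inj (flipK A).
by rewrite /flip /=; case: (a \in A); [symmetry|]; exact: b.
Qed.

Lemma swapK x y : involutive (swap x y).
Proof.
move=> e; rewrite /swap /=; case: (e =P x) => [->|ex].
  by rewrite eqxx; case: eqP.
case: (e =P y) => [->|ey]; first by rewrite eqxx.
by case: eqP => // _; case: eqP.
Qed.

Lemma swaps_inj ps : injective (swaps ps).
Proof.
elim: ps => //= p ps IH e f /(inv_inj (@swapK _ _)) /IH //.
Qed.

(** An injection of a finite set into itself is a permutation. *)
Lemma ends_swaps ps s : wf s -> all (fun p => (p.1 \in ends s) && (p.2 \in ends s)) ps ->
  perm_eq (ends s) (ends (relabel (swaps ps) s)).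
Proof.
move=> [u _] hp; rewrite ends_relabel perm_sym.
have sub : {subset map (swaps ps) (ends s) <= ends s}.
  move=> _ /mapP [e he ->]; elim: ps hp => //= p ps IH /andP [/andP [p1 p2] /IH {}IH].
  by rewrite /swap /=; case: eqP => // _; case: eqP.
have um : uniq (map (swaps ps) (ends s)) by rewrite map_inj_uniq //; apply: swaps_inj.
apply: uniq_perm => //.
by case: (uniq_min_size um sub) => //; rewrite size_map.
Qed.

Lemma wf_swaps ps s : wf s -> all (fun p => (p.1 \in ends s) && (p.2 \in ends s)) ps ->
  wf (relabel (swaps ps) s).
Proof. by move=> hs hp; apply: wf_perm (ends_swaps hs hp) hs. Qed.

Lemma prec_ends s x y : prec s x y -> (x \in ends s) /\ (y \in ends s).
Proof.
case/existsP => k /infixP [l [r e]].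
by split; apply: (@mem_ends _ k); rewrite e mem_cat !inE eqxx !orbT.
Qed.

Lemma adj_ends s x y : adj s x y -> (x \in ends s) && (y \in ends s).
Proof. by case/orP => /prec_ends [-> ->]. Qed.

Lemma w_equiv_R1 s g a : wf s -> adj s (tail_of a) (head_of a) ->
  w_equiv M (s, g) (erase [:: a] s, g).
Proof.
move=> hs ha; apply: (w_equiv_step (h := hs) (h' := wf_erase [:: a] hs)); right.
by constructor 1; exists a; split.
Qed.

Lemma w_equiv_R2 s g a b : wf s -> g a = ~~ g b -> adj s (tail_of a) (tail_of b) ->
  adj s (head_of a) (head_of b) -> w_equiv M (s, g) (erase [:: a; b] s, g).
Proof.
move=> hs gab ht hh; apply: (w_equiv_step (h := hs) (h' := wf_erase [:: a; b] hs)); right.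
by constructor 2; exists a, b; split.
Qed.

Lemma w_equiv_OC s g a b : wf s -> adj s (tail_of a) (tail_of b) ->
  w_equiv M (s, g) (relabel (swaps [:: (tail_of a, tail_of b)]) s, g).
Proof.
move=> hs ht.
have hs' : wf (relabel (swaps [:: (tail_of a, tail_of b)]) s).
  by apply: wf_swaps => //=; rewrite (adj_ends ht).
apply: (w_equiv_step (h := hs) (h' := hs')); right.
by constructor 4; exists a, b; split.
Qed.

End RawDiagrams.

(** * Substituting words for endpoints *)

Section Substitution.
Variable n : nat.
Implicit Types (s : 'I_n -> seq endpoint) (g : nat -> bool) (e x y z : endpoint).

Lemma w_related_of_w_equiv M (D E : gauss_diagram n) :
  w_equiv M (strand D, sgn D) (strand E, sgn E) -> w_related M D E.
Proof.
case=> hD [hE h]; apply: rt_trans (rt_trans _ _ _ _ _ h _);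
  by apply: rt_step; constructor 1; apply: diagram_iso_ext.
Qed.

Lemma wf_diagram (D : gauss_diagram n) : wf (strand D).
Proof. split; [exact: endpoints_uniq|exact: tail_head]. Qed.

(** Relabellings and the direction of the move are absorbed by the symmetry of
    [w_related]. *)
Lemma w_related_one_move (M1 M2 : local_move) (D D' : gauss_diagram n) :
  (forall E E' : gauss_diagram n, M1 n E E' -> w_equiv M2 (strand E, sgn E) (strand E', sgn E')) ->
  one_move M1 D D' -> w_related M2 D D'.
Proof.
move=> h [E [E' [hD hD' hM]]].
have hE : w_related M2 E E'.
  by case: hM => /h/w_related_of_w_equiv // ?; apply: w_related_sym.
apply: rt_trans (rt_trans _ _ _ _ _ hE _); apply: rt_step; constructor 1 => //.
exact: diagram_iso_sym.
Qed.

Lemma infix_index (w : seq endpoint) x y :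
  uniq w -> infix [:: x; y] w -> index y w = (index x w).+1.
Proof.
move=> + /infixP [l [r e]]; rewrite {w}e cat_uniq => /and3P [_ /hasPn h /=].
rewrite inE negb_or => /andP [/andP [xy _] _].
have xl : x \notin l by apply: h; rewrite inE eqxx.
have yl : y \notin l by apply: h; rewrite !inE eqxx orbT.
rewrite !index_cat (negbTE xl) (negbTE yl) /= !eqxx (negbTE xy); lia.
Qed.

Lemma precC s x y : wf s -> adj s x y -> prec s y x = ~~ prec s x y.
Proof.
move=> hs; suff h u v : prec s u v -> prec s v u -> False.
  have := h x y; rewrite /adj; case: (prec s x y) (prec s y x) => [] [] //= h' _.
  by case: h'.
case/existsP => j h1 /existsP [k h2].
have mj : u \in s j by case/infixP: h1 => l [r ->]; rewrite mem_cat inE eqxx orbT.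
have mk : u \in s k by case/infixP: h2 => l [r ->]; rewrite mem_cat !inE eqxx !orbT.
move: h2; rewrite -(wf_strand hs mj mk) => /(infix_index (wf_uniq j hs)).
have := infix_index (wf_uniq j hs) h1; lia.
Qed.

Lemma adjC s x y : adj s x y = adj s y x. Proof. exact: orbC. Qed.

(** Local modifications are described by the words that replace the letters concerned.
    The relative positions of the portions, which may lie on any strands in any order, then
    never have to be distinguished. *)
Definition subst_word (f : endpoint -> seq endpoint) (w : seq endpoint) := flatten (map f w).
Definition substitute f s : 'I_n -> seq endpoint := fun k => subst_word f (s k).

Lemma subst_word_cat f v w : subst_word f (v ++ w) = subst_word f v ++ subst_word f w.
Proof. by rewrite /subst_word map_cat flatten_cat. Qed.

Lemma subst_word_id f w : {in w, forall e, f e = [:: e]} -> subst_word f w = w.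
Proof.
move=> h; rewrite /subst_word (_ : map f w = map (fun e => [:: e]) w) ?flatten_seq1 //.
exact/eq_in_map.
Qed.

Lemma ends_substitute f s : ends (substitute f s) = subst_word f (ends s).
Proof.
rewrite /ends /subst_word /substitute; elim: (enum 'I_n) => //= k ks ->.
by rewrite -subst_word_cat.
Qed.

Lemma prec_substitute f s k l v r u x y :
  s k = l ++ v ++ r -> subst_word f v = u -> infix [:: x; y] u -> prec (substitute f s) x y.
Proof.
move=> sk <- h; apply/existsP; exists k; rewrite /substitute sk !subst_word_cat.
by apply/infixP; case/infixP: h => a [b ->];
  exists (subst_word f l ++ a), (b ++ subst_word f r); rewrite -!catA.
Qed.

Definition new_ends (N : seq nat) := flatten [seq [:: tail_of a; head_of a] | a <- N].

Lemma mem_new_ends N e : (e \in new_ends N) = (e.1 \in N).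
Proof.
by case: e => b [] /=; elim: N => //= a N IH; rewrite !inE IH !xpair_eqE /= ?andbT ?andbF ?orbF.
Qed.

Lemma new_ends_uniq N : uniq N -> uniq (new_ends N).
Proof.
elim: N => //= a N IH /andP [aN /IH u]; rewrite !inE mem_new_ends mem_new_ends /= (negbTE aN) u.
by rewrite xpair_eqE andbF.
Qed.

(** If the words replacing the letters of [X] contain these letters and both ends of new
    arrows, each once, the result is a diagram. *)
Lemma wf_substitute f s X N : wf s -> uniq X -> {subset X <= ends s} ->
  {in ends s, forall e, e \notin X -> f e = [:: e]} ->
  perm_eq (subst_word f X) (X ++ new_ends N) ->
  uniq N -> {in ends s, forall e, e.1 \notin N} -> wf (substitute f s).
Proof.
move=> [u b] uX sX fid pX uN fresh.
pose R := [seq e <- ends s | e \notin X].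
have pR : perm_eq (ends s) (X ++ R).
  apply: uniq_perm => //.
    rewrite cat_uniq uX filter_uniq // andbT; apply/hasPn => e.
    by rewrite mem_filter => /andP [].
  move=> e; rewrite mem_cat mem_filter; case eX: (e \in X) => //=.
  exact: sX.
have p : perm_eq (ends (substitute f s)) (ends s ++ new_ends N).
  rewrite ends_substitute; apply: (perm_trans (y := subst_word f (X ++ R))).
    exact/perm_flatten/perm_map.
  rewrite subst_word_cat (@subst_word_id f R); last first.
    by move=> e; rewrite mem_filter => /andP [eX es]; apply: fid.
  apply: (perm_trans (y := (X ++ new_ends N) ++ R)); first by rewrite perm_cat2r.
  by rewrite -catA perm_catCA perm_sym perm_catC perm_cat2l.
split.
  rewrite (perm_uniq p) cat_uniq u new_ends_uniq // andbT.
  apply/hasPn => e; rewrite mem_new_ends => eN; apply/negP => /fresh.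
  by rewrite eN.
by move=> a; rewrite !(perm_mem p) !mem_cat b !mem_new_ends.
Qed.

Lemma map_subst_word (h : endpoint -> endpoint) f w : map h (subst_word f w) = subst_word (map
  h \o f) w.
Proof. by rewrite /subst_word map_flatten -map_comp. Qed.

Lemma filter_subst_word (p : pred endpoint) f w : filter p (subst_word f w) = subst_word
  (filter p \o f) w.
Proof. by rewrite /subst_word filter_flatten -map_comp. Qed.

Lemma eq_in_subst_word f f' w : {in w, f =1 f'} -> subst_word f w = subst_word f' w.
Proof. by move=> h; congr flatten; apply/eq_in_map. Qed.

Lemma relabel_substitute h f f' s : {in ends s, forall e, map h (f e) = f' e} ->
  relabel h (substitute f s) =1 substitute f' s.
Proof.
move=> hf k; rewrite /relabel /substitute map_subst_word;
  apply: eq_in_subst_word => e /mem_ends; exact: hf.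
Qed.

Lemma erase_substitute A f f' s :
  {in ends s, forall e, [seq x <- f e | x.1 \notin A] = f' e} ->
  erase A (substitute f s) =1 substitute f' s.
Proof.
move=> hf k; rewrite /erase /substitute filter_subst_word;
  apply: eq_in_subst_word => e /mem_ends; exact: hf.
Qed.

Lemma w_equiv_flip (M : local_move) s g A : wf s ->
  (forall (h : wf s) (h' : wf (relabel (flip A) s)),
     M n (diagram_of g h) (diagram_of (toggle A g) h')) ->
  w_equiv M (s, g) (relabel (flip A) s, toggle A g).
Proof.
move=> hs hM; apply: (w_equiv_step (h := hs) (h' := wf_flip A hs)); left; exact: hM.
Qed.

(** * Crossing changes realize the band-pass *)

Lemma w_equiv_CC s g a : wf s -> tail_of a \in ends s ->
  w_equiv CC (s, g) (relabel (flip [:: a]) s, toggle [:: a] g).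
Proof. by move=> hs ha; apply: w_equiv_flip => // h h'; exists a; split. Qed.

Lemma w_equiv_CCs A s g : wf s -> uniq A -> {in A, forall a, tail_of a \in ends s} ->
  w_equiv CC (s, g) (relabel (flip A) s, toggle A g).
Proof.
elim: A s g => [|a A IH] s g hs /=.
  move=> _ _; apply: w_equiv_ext => // k; rewrite /relabel -[LHS]map_id.
  by apply: eq_map => -[].
case/andP => aA uA hA.
have ha : tail_of a \in ends s by apply: hA; rewrite inE eqxx.
apply: w_equiv_trans (w_equiv_CC g hs ha) _.
have hs' := wf_flip [:: a] hs.
apply: w_equiv_trans (IH _ (toggle [:: a] g) hs' uA _) _.
  move=> b bA; rewrite ends_relabel; apply/mapP; exists (tail_of b); first by apply: hA;
    rewrite inE bA orbT.
  by rewrite /flip /= inE; case: eqP => // ba; rewrite -ba bA in aA.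
apply: w_equiv_ext; first exact: wf_flip.
  move=> k; rewrite /relabel -map_comp; apply: eq_map => -[b c]; rewrite /flip /= !inE.
  by case: eqP => // ->; rewrite (negbTE aA).
move=> b _; rewrite /toggle !inE; case: eqP => // ->; by rewrite (negbTE aA).
Qed.

End Substitution.

Theorem CC_generates_BP : w_generates CC BP.
Proof.
move=> n _ D D'; apply: w_related_one_move => {D D'} E E'.
case=> [a [b [c [d [u [h1 h2 h3 h4] _ [rs rg]]]]]].
have tl x y : adjacent E (tail_of x) (tail_of y) ->
  (tail_of x \in ends (strand E)) && (tail_of y \in ends (strand E)).
  by move=> h; apply: adj_ends; apply: h.
have /andP [ha hb] := tl _ _ h1; have /andP [hc hd] := tl _ _ h2.
have sub : {in [:: a; b; c; d], forall x, tail_of x \in ends (strand E)}.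
  by move=> x; rewrite !inE => /or4P [] /eqP ->.
apply: w_equiv_trans (w_equiv_CCs (sgn E) (wf_diagram E) u sub) _.
apply: w_equiv_ext; first exact/wf_flip/wf_diagram.
  by move=> k; rewrite rs.
move=> x hx; rewrite rg //.
move: hx; rewrite ends_relabel => /mapP [[y t] hy [-> _]].
exact: (@arrowsP _ E (y, t)).
Qed.

(** * The band-pass realizes the exchange of a head and a tail *)

Lemma fresh_labels (w : seq endpoint) (m : nat) : exists L : seq nat,
  [/\ size L = m, uniq L & {in w, forall e, e.1 \notin L}].
Proof.
exists (iota (\sum_(e <- w) e.1).+1 m); split; rewrite ?size_iota ?iota_uniq //.
move=> e ew; rewrite mem_iota negb_and -leqNgt; apply/orP; left.
by rewrite (big_rem e ew) /= leq_addr.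
Qed.

(** On words of symbolic letters [perm_eq] does not compute, but the counts of an arbitrary
    predicate unfold to sums that can be compared. *)
Ltac count_letters :=
  apply/permP; let P := fresh "P" in move=> P /=;
  unfold head_of, tail_of;
  repeat match goal with |- context [nat_of_bool ?b] =>
    let c := fresh "c" in generalize (nat_of_bool b) => c end;
  clear; lia.

Lemma w_equiv_rename n M (s s' : 'I_n -> seq endpoint) g g' (f : nat -> nat) : wf s ->
  injective f ->
  s' =1 relabel (fun e => (f e.1, e.2)) s ->
  (forall a, tail_of a \in ends s -> g' (f a) = g a) -> w_equiv M (s, g) (s', g').
Proof.
move=> hs fi es hg.
have Fi : injective (fun e : endpoint => (f e.1, e.2)).
  by move=> [a b] [c d] [/fi /= -> ->].
have hs' : wf s'.
  split; first by rewrite (eq_ends es) ends_relabel map_inj_uniq // hs.1.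
  move=> a; rewrite (eq_ends es) ends_relabel.
  by apply/mapP/mapP => -[[b c] hb [-> ec]] /=; [exists (head_of b)|exists (tail_of b)];
    rewrite // ?hs.2 -?hs.2; move: hb; rewrite /= -ec ?hs.2.
exists hs, hs'; apply: rt_step; constructor 1; exists f; split.
- by move=> a b _ _ /fi.
- by move=> k; rewrite /= es.
- by move=> a ha; apply: hg.
Qed.

(** The exchange of the adjacent ends [H_o T_d], with labels [p], [q], [i], [j] for the
    auxiliary arrows. *)
Section Exchange.
Variables (n : nat) (s : 'I_n -> seq endpoint) (g : nat -> bool) (o d : nat).
Hypothesis hs : wf s.
Hypothesis pod : prec s (head_of o) (tail_of d).
Variables (p q i j : nat).
Hypothesis u6 : uniq [:: o; d; p; q; i; j].
Hypothesis fresh : {in ends s, forall e, e.1 \notin [:: p; q; i; j]}.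

(** All the diagrams of the sequence differ from the initial one only in the words that
    stand for the head of [o], the tail of [d] and the tail of [o]. *)
Let sub (wH wD wT : seq endpoint) (e : endpoint) : seq endpoint :=
  if e == head_of o then wH else if e == tail_of d then wD
  else if e == tail_of o then wT else [:: e].
Let S (wH wD wT : seq endpoint) := substitute (sub wH wD wT) s.

Let neqs : ((o == d) = false) * ((d == o) = false) * ((o == p) = false) * ((p == o) = false)
  * ((o == q) = false) * ((q == o) = false) * ((o == i) = false) * ((i == o) = false)
  * ((o == j) = false) * ((j == o) = false) * ((d == p) = false) * ((p == d) = false)
  * ((d == q) = false) * ((q == d) = false) * ((d == i) = false) * ((i == d) = false)
  * ((d == j) = false) * ((j == d) = false) * ((p == q) = false) * ((q == p) = false)
  * ((p == i) = false) * ((i == p) = false) * ((p == j) = false) * ((j == p) = false)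
  * ((q == i) = false) * ((i == q) = false) * ((q == j) = false) * ((j == q) = false)
  * ((i == j) = false) * ((j == i) = false).
Proof.
move: u6; rewrite /= !inE !negb_or -!andbA.
do 14 case/andP => [/negbTE ?]; case/andP => [/negbTE ? _].
by repeat split; rewrite // eq_sym.
Qed.

Let subE wH wD wT : (sub wH wD wT (head_of o) = wH) * (sub wH wD wT (tail_of d) = wD)
  * (sub wH wD wT (tail_of o) = wT).
Proof. by rewrite /sub !xpair_eqE !eqxx /= !andbF neqs. Qed.

Let Ho_in : head_of o \in ends s. Proof. by case: (prec_ends pod). Qed.
Let Td_in : tail_of d \in ends s. Proof. by case: (prec_ends pod). Qed.
Let To_in : tail_of o \in ends s. Proof. by rewrite hs.2. Qed.

Let X := [:: head_of o; tail_of d; tail_of o].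

Let subP (P : endpoint -> seq endpoint -> seq endpoint -> Prop) wH wD wT wH' wD' wT' :
  P (head_of o) wH wH' -> P (tail_of d) wD wD' -> P (tail_of o) wT wT' ->
  (forall e, e \in ends s -> e \notin X -> P e [:: e] [:: e]) ->
  {in ends s, forall e, P e (sub wH wD wT e) (sub wH' wD' wT' e)}.
Proof.
move=> h1 h2 h3 h4 e es; rewrite /sub.
case: eqP => [->//|/eqP eH]; case: eqP => [->//|/eqP eD]; case: eqP => [->//|/eqP eT].
by apply: h4; rewrite // !inE !negb_or eH eD.
Qed.

(** The letters that keep their place carry none of the labels involved in the moves. *)
Let generic e : e \in ends s -> e \notin X ->
  [/\ (e.1 == o) = false, (e == tail_of d) = false, (e.1 == p) = false, (e.1 == q) = false
    & (e.1 == i) = false /\ (e.1 == j) = false].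
Proof.
move=> /fresh; rewrite !inE !negb_or => /and4P [/negbTE -> /negbTE -> /negbTE -> /negbTE ->].
by case: e => a []; rewrite !xpair_eqE !andbT !andbF /= => /andP [/negbTE -> ]// /negbTE ->.
Qed.

Let wfS wH wD wT : perm_eq (wH ++ wD ++ wT) (X ++ new_ends [:: p; q; i; j]) -> wf (S wH wD wT).
Proof.
move=> pe; apply: (wf_substitute (X := X) (N := [:: p; q; i; j])) => //.
- by rewrite /= !inE !xpair_eqE /= !andbF !neqs.
- by move=> e; rewrite !inE => /or3P [] /eqP ->.
- move=> e es; rewrite !inE !negb_or => /and3P [/negbTE h1 /negbTE h2 /negbTE h3].
  by rewrite /sub h1 h2 h3.
- by rewrite /subst_word /= !subE cats0.
- by move: u6; rewrite -[_ :: _]/([:: o; d] ++ [:: p; q; i; j]) cat_uniq => /and3P [].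
Qed.

Let delS A wH wD wT : {subset A <= [:: o; p; q; i; j]} ->
  let keep := filter (fun x : endpoint => x.1 \notin A) in
  erase A (S wH wD wT) =1 S (keep wH) (keep wD) (keep wT).
Proof.
move=> sA keep; apply: erase_substitute; apply: (subP (P := fun e w w' => keep w = w')) => //.
move=> e es eX; rewrite /keep /=; case: (generic es eX) => [h1 _ h2 h3 [h4 h5]].
case: ifP => // /negbFE /sA; by rewrite !inE h1 h2 h3 h4 h5.
Qed.

Let remapS h wH wD wT : (forall e, e \in ends s -> e \notin X -> h e = e) ->
  relabel h (S wH wD wT) =1 S (map h wH) (map h wD) (map h wT).
Proof.
move=> hh; apply: relabel_substitute; apply: (subP (P := fun e w w' => map h w = w')) => // e es eX.
by rewrite /= hh.
Qed.

Let prec_word wH wD wT x y : (infix [:: x; y] wT) || (infix [:: x; y] (wH ++ wD)) ->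
  prec (S wH wD wT) x y.
Proof.
case/orP => h.
  case/endsP: To_in => k hk.
  have [l [r sk]] : exists l r, s k = l ++ [:: tail_of o] ++ r.
    by case/splitPr: hk => l r; exists l, r.
  by apply: prec_substitute sk _ h; rewrite /subst_word /= subE cats0.
case/existsP: pod => k /infixP [l [r sk]].
apply: prec_substitute sk _ h; by rewrite /subst_word /= !subE cats0.
Qed.

Let S0 : S [:: head_of o] [:: tail_of d] [:: tail_of o] =1 s.
Proof.
move=> k; apply: subst_word_id => e _; rewrite /sub.
by case: eqP => [->//|_]; case: eqP => [->//|_]; case: eqP => [->|].
Qed.

Let w_equiv_eq (s1 s2 : 'I_n -> seq endpoint) g' : wf s1 -> s1 =1 s2 ->
  w_equiv BP (s1, g') (s2, g').
Proof. by move=> h e; apply: w_equiv_ext. Qed.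

Let delR1 a wH wD wT wH' wD' wT' g' : a \in [:: o; p; q; i; j] -> wf (S wH wD wT) ->
  adj (S wH wD wT) (tail_of a) (head_of a) ->
  [/\ [seq x <- wH | x.1 \notin [:: a]] = wH', [seq x <- wD | x.1 \notin [:: a]] = wD' &
      [seq x <- wT | x.1 \notin [:: a]] = wT'] ->
  w_equiv BP (S wH wD wT, g') (S wH' wD' wT', g').
Proof.
move=> ha h w [<- <- <-]; apply: w_equiv_trans (w_equiv_R1 BP g' h w) _;
  apply: w_equiv_eq (wf_erase _ h) _.
by apply: delS => x; rewrite inE => /eqP ->.
Qed.

Let delR2 a b wH wD wT wH' wD' wT' g' :
  {subset [:: a; b] <= [:: o; p; q; i; j]} -> wf (S wH wD wT) ->
  g' a = ~~ g' b -> adj (S wH wD wT) (tail_of a) (tail_of b) ->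
    adj (S wH wD wT) (head_of a) (head_of b) ->
  [/\ [seq x <- wH | x.1 \notin [:: a; b]] = wH', [seq x <- wD | x.1 \notin [:: a; b]] = wD' &
      [seq x <- wT | x.1 \notin [:: a; b]] = wT'] ->
  w_equiv BP (S wH wD wT, g') (S wH' wD' wT', g').
Proof.
move=> ha h ab w w' [<- <- <-]; apply: w_equiv_trans (w_equiv_R2 BP h ab w w') _;
  apply: w_equiv_eq (wf_erase _ h) _.
exact: delS.
Qed.

Let swapOC a wH wD wT wH' wD' wT' g' : a \in [:: o; p; q; i; j] -> wf (S wH wD wT) ->
  adj (S wH wD wT) (tail_of a) (tail_of d) ->
  let h := swap (tail_of a) (tail_of d) in
  [/\ map h wH = wH', map h wD = wD' & map h wT = wT'] ->
  w_equiv BP (S wH wD wT, g') (S wH' wD' wT', g').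
Proof.
move=> ha hw w h [<- <- <-]; apply: w_equiv_trans (w_equiv_OC BP g' hw w) _; apply: w_equiv_eq.
  by apply: wf_swaps => //=; rewrite (adj_ends w).
apply: remapS => e es eX; rewrite /swaps /h /= /swap /=.
case: (generic es eX) => h1 -> h2 h3 [h4 h5]; case: eqP => // e'; move: ha.
by rewrite !inE -[a]/((tail_of a).1) -e' h1 h2 h3 h4 h5.
Qed.

Hypothesis gp : g p = ~~ g o.
Hypothesis gq : g q = g o.
Hypothesis gi : g i = g o.
Hypothesis gj : g j = ~~ g o.

Local Notation T := tail_of.
Local Notation H := head_of.

Ltac inlist := by rewrite ?inE ?eqxx ?orbT.
Ltac inlists := by let x := fresh in move=> x; rewrite !inE => /orP [] /eqP->; rewrite ?eqxx ?orbT.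
Ltac word := by apply: prec_word; rewrite /= ?xpair_eqE ?eqxx ?neqs /= ?orbT.
Ltac words := rewrite /adj; apply/orP; first [left; word | right; word].
Ltac wstep := by split; cbn [map filter];
  rewrite /swap /= ?inE /= ?xpair_eqE /= ?inE /= ?eqxx ?neqs /= ?eqxx ?neqs.

(** Undoing the insertions: [j] is a curl once its tail has passed that of [d], [i] is a curl,
    and [p], [q] form an R2 pair. *)
Let exchange_before :
  w_equiv BP (S [:: H o] [:: H i; T i; T j; T d; H j; H p; H q] [:: T o; T p; T q], g) (s, g).
Proof.
have w3 : wf (S [:: H o] [:: H i; T i; T j; T d; H j; H p; H q] [:: T o; T p; T q]).
  by apply: wfS; count_letters.
have r1 : w_equiv BP (S [:: H o] [:: H i; T i; T j; T d; H j; H p; H q] [:: T o; T p; T q], g)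
 (S [:: H o] [:: H i; T i; T d; T j; H j; H p; H q] [:: T o; T p; T q], g).
  by apply: (swapOC (a := j)); [inlist|exact: w3|words|wstep].
apply: w_equiv_trans (r1) _.
have r2 : w_equiv BP (S [:: H o] [:: H i; T i; T d; T j; H j; H p; H q] [:: T o; T p; T q], g)
  (S [:: H o] [:: T d; T j; H j; H p; H q] [:: T o; T p; T q], g).
  by apply: (delR1 (a := i)); [inlist|exact: w_equiv_wfr r1|words|wstep].
apply: w_equiv_trans (r2) _.
have r3 : w_equiv BP (S [:: H o] [:: T d; T j; H j; H p; H q] [:: T o; T p; T q], g)
  (S [:: H o] [:: T d; H p; H q] [:: T o; T p; T q], g).
  by apply: (delR1 (a := j)); [inlist|exact: w_equiv_wfr r2|words|wstep].
apply: w_equiv_trans (r3) _.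
have r4 : w_equiv BP (S [:: H o] [:: T d; H p; H q] [:: T o; T p; T q], g)
  (S [:: H o] [:: T d] [:: T o], g).
  by apply: (delR2 (a := p) (b := q)); [inlists|exact: w_equiv_wfr r3|rewrite gp
    gq|words|words|wstep].
apply: w_equiv_trans (r4) _.
exact: w_equiv_eq (w_equiv_wfr r4) S0.
Qed.

(** After the band-pass the ends of [o] and [p] are tails, hence commute with that of [d],
    and the two arrows cancel each other. *)
Let exchange_after : wf (S [:: T o] [:: T i; H i; H j; T d; T j; T p; H q] [:: H o; H p; T q]) ->
  let g4 := toggle [:: o; p; i; j] g in
  w_equiv BP (S [:: T o] [:: T i; H i; H j; T d; T j; T p; H q] [:: H o; H p; T q], g4)
    (S [:: T d] [:: H q] [:: T q], g4).
Proof.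
move=> w4 g4.
have r1 : w_equiv BP (S [:: T o] [:: T i; H i; H j; T d; T j; T p; H q] [:: H o; H p; T q], g4)
  (S [:: T o] [:: H j; T d; T j; T p; H q] [:: H o; H p; T q], g4).
  by apply: (delR1 (a := i)); [inlist|exact: w4|words|wstep].
apply: w_equiv_trans (r1) _.
have r2 : w_equiv BP (S [:: T o] [:: H j; T d; T j; T p; H q] [:: H o; H p; T q], g4)
  (S [:: T o] [:: H j; T j; T d; T p; H q] [:: H o; H p; T q], g4).
  by apply: (swapOC (a := j)); [inlist|exact: w_equiv_wfr r1|words|wstep].
apply: w_equiv_trans (r2) _.
have r3 : w_equiv BP (S [:: T o] [:: H j; T j; T d; T p; H q] [:: H o; H p; T q], g4)
  (S [:: T o] [:: T d; T p; H q] [:: H o; H p; T q], g4).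
  by apply: (delR1 (a := j)); [inlist|exact: w_equiv_wfr r2|words|wstep].
apply: w_equiv_trans (r3) _.
have r4 : w_equiv BP (S [:: T o] [:: T d; T p; H q] [:: H o; H p; T q], g4)
  (S [:: T d] [:: T o; T p; H q] [:: H o; H p; T q], g4).
  by apply: (swapOC (a := o)); [inlist|exact: w_equiv_wfr r3|words|wstep].
apply: w_equiv_trans (r4) _.
apply: (delR2 (a := o) (b := p)); [inlists|exact: w_equiv_wfr r4| |words|words|wstep].
by rewrite /g4 /toggle !inE !eqxx !orbT gp negbK.
Qed.

Let exchange_band_pass :
  w_equiv BP (S [:: H o] [:: H i; T i; T j; T d; H j; H p; H q] [:: T o; T p; T q], g)
  (S [:: T o] [:: T i; H i; H j; T d; T j; T p; H q] [:: H o; H p; T q], toggle [:: o; p; i; j] g).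
Proof.
set s3 := S [:: H o] _ _; have w3 : wf s3 := w_equiv_wfl exchange_before.
apply: w_equiv_trans (w_equiv_flip (A := [:: o; p; i; j]) w3 _) _.
  move=> h h'; exists o, p, i, j.
  have e1 : prec s3 (T o) (T p) by word.
  have e2 : prec s3 (T i) (T j) by word.
  have e3 : prec s3 (H o) (H i) by word.
  have e4 : prec s3 (H j) (H p) by word.
  have e4' : prec s3 (H p) (H j) = false by rewrite (precC w3) ?e4 // /adj e4.
  have ad x y : adjacent (diagram_of g h) x y = prec s3 x y || prec s3 y x by [].
  have pr x y : precedes (diagram_of g h) x y = prec s3 x y by [].
  split.
  - by rewrite /= !inE !neqs.
  - by rewrite !ad e1 e2 e3 e4 !orbT.
  (* The portion [H_j H_p] meets the arrows in the order opposite to [H_o H_i]; the sign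
     of [p], opposite to that of [o], compensates for it. *)
  - rewrite /eta !pr e1 e2 e3 e4' /eps /= gp gi gj.
    by case: (g o).
  - by split.
apply: w_equiv_eq; first exact: wf_flip.
move=> k; rewrite remapS ?[map _ _]/= //.
  by rewrite /flip /= !inE !eqxx !neqs !orbT.
move=> e es eX; case: (generic es eX) => h1 _ h2 _ [h4 h5].
by case: e h1 h2 h4 h5 {es eX} => a b /= h1 h2 h4 h5; rewrite /flip /= !inE h1 h2 h4 h5.
Qed.

Lemma exchange_step : w_equiv BP (s, g) (relabel (swaps [:: (H o, T d)]) s, g).
Proof.
have r := w_equiv_trans (w_equiv_trans (w_equiv_sym exchange_before) exchange_band_pass)
                    (exchange_after (w_equiv_wfr exchange_band_pass)).
apply: w_equiv_trans (r) _.
(* The arrow that remains, [q], takes over the label of [o]. *)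
pose f a := if a == o then q else if a == q then o else a.
have fi : involutive f.
  by move=> a; rewrite /f; case: (a =P o) => [->|/eqP /negbTE e1];
    [rewrite eqxx neqs //|case: (a =P q) => [->|/eqP /negbTE e2]; rewrite ?eqxx // e1 e2].
apply: (@w_equiv_rename _ _ _ _ _ _ f).
- exact: w_equiv_wfr r.
- exact: inv_inj fi.
- move=> k; rewrite remapS; last first.
    move=> e es eX; case: (generic es eX) => h1 _ _ h2 _.
    by rewrite /f h1 h2; case: (e).
  have -> : relabel (swaps [:: (H o, T d)]) s k =
      relabel (swaps [:: (H o, T d)]) (S [:: H o] [:: T d] [:: T o]) k.
    by rewrite /relabel S0.
  rewrite remapS; last first.
    move=> e es eX; case: (generic es eX) => h1 h2 _ _ _.
    rewrite /swaps /= /swap /= h2; case: eqP => // e'; by rewrite e' eqxx in h1.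
  by rewrite /swaps /= /swap /= /f !xpair_eqE /= !eqxx !neqs.
- move=> a; rewrite ends_substitute => /flattenP [_ /mapP [e es ->]].
  rewrite /toggle /f /sub !inE.
  case: ifP => _; first by rewrite !inE => /eqP [->]; rewrite !neqs.
  case: ifP => _; first by rewrite !inE => /eqP [].
  case: ifP => [_|eT]; first by rewrite !inE => /eqP [->]; rewrite !eqxx !neqs /= gq.
  rewrite inE => /eqP ae; move: (fresh es); rewrite -ae !inE !negb_or /=.
  case/and4P => /negbTE -> /negbTE -> /negbTE -> /negbTE ->.
  by case: eqP => // ao; rewrite -ae ao eqxx in eT.
Qed.
End Exchange.

Section HeadTailExchange.
Variable n : nat.
Implicit Types (s : 'I_n -> seq endpoint) (g : nat -> bool) (e x y z : endpoint).

Lemma prec_relabel h s x y x' y' : prec s x y -> h x = x' -> h y = y' -> prec (relabel h s) x' y'.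
Proof.
case/existsP => k /infixP [l [r sk]] <- <-; apply/existsP; exists k; apply/infixP.
by exists (map h l), (map h r); rewrite /relabel sk map_cat map_cat.
Qed.

Lemma adj_relabel h s x y x' y' : adj s x y -> h x = x' -> h y = y' -> adj (relabel h s) x' y'.
Proof. by case/orP => p hx hy; apply/orP; [left|right]; apply: prec_relabel p _ _. Qed.

Lemma w_equiv_BP_exchange s g o d : wf s -> o != d -> adj s (head_of o) (tail_of d) ->
  w_equiv BP (s, g) (relabel (swap (head_of o) (tail_of d)) s, g).
Proof.
move=> hs od.
(* The exchange is an involution, so one order of the two ends is enough. *)
suff main s1 : wf s1 -> prec s1 (head_of o) (tail_of d) ->
  w_equiv BP (s1, g) (relabel (swap (head_of o) (tail_of d)) s1, g).
  case/orP => [|p]; first exact: main.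
  set s1 := relabel _ s.
  have w1 : wf s1.
    apply: (wf_swaps (ps := [:: (head_of o, tail_of d)])) => //=.
    by case/prec_ends: p => -> ->.
  have p1 : prec s1 (head_of o) (tail_of d).
    by apply: prec_relabel p _ _; rewrite /swap /= ?eqxx ?xpair_eqE ?andbF ?eqxx.
  apply: w_equiv_sym; apply: w_equiv_trans (main s1 w1 p1) _; apply: w_equiv_ext => //.
    apply: (wf_swaps (ps := [:: (head_of o, tail_of d)])) => //=.
    by case/prec_ends: p1 => -> ->.
  by move=> k; rewrite /s1 /relabel -map_comp -[RHS]map_id; apply: eq_map => e /=; rewrite swapK.
move=> {}hs p.
have [L [sL uL fL]] := fresh_labels (ends s1) 4.
case: L sL uL fL => [//|a [//|b [//|i [//|j []//]]]] _ uL fL.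
have [hin tin] := prec_ends p.
have u6 : uniq [:: o; d; a; b; i; j].
  have ho := fL _ hin; have hd := fL _ tin; rewrite /= in ho hd.
  by rewrite /= in_cons negb_or od ho hd.
pose g' c := if c \in [:: a; b; i; j] then (if (c == b) || (c == i) then g o else ~~ g o) else g c.
have gg' : same_signs s1 g g'.
  by move=> x xs; have /= xL := fL _ xs; rewrite /g' (negbTE xL).
have go : g' o = g o by rewrite /g' (negbTE (fL _ hin)).
have r0 : w_equiv BP (s1, g) (s1, g') by apply: w_equiv_ext.
have u4 := uL; move: uL; rewrite /= !inE !negb_or => /and4P [/and3P [ab ai aj] /andP [bi bj] ij _].
apply: w_equiv_trans (r0) _.
apply: w_equiv_trans (exchange_step hs p u6 fL (g := g') _ _ _ _) _.
- by rewrite go /g' !inE eqxx (negbTE ab) (negbTE ai).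
- by rewrite go /g' !inE !eqxx orbT.
- by rewrite go /g' !inE !eqxx !orbT.
- by rewrite go /g' !inE !eqxx !orbT [j == b]eq_sym [j == i]eq_sym (negbTE bj) (negbTE ij).
have es : perm_eq (ends s1) (ends (relabel (swaps [:: (head_of o, tail_of d)]) s1)).
  by apply: ends_swaps => //=; rewrite hin tin.
apply: w_equiv_ext => //; first exact: wf_perm es hs.
by move=> x; rewrite -(perm_mem es) => xs; symmetry; apply: gg'.
Qed.

End HeadTailExchange.

Theorem BP_generates_Delta : w_generates BP Delta.
Proof.
move=> n _ D D'; apply: w_related_one_move => {D D'} E E'.
case=> [a [b [c [u [h1 h2 h3] _ _ [es eg]]]]].
have h1' : adj (strand E) (head_of c) (tail_of a) := h1.
have h2' : adj (strand E) (head_of a) (tail_of b) := h2.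
have h3' : adj (strand E) (head_of b) (tail_of c) := h3.
move: u; rewrite /= !inE negb_or andbT => /andP [/andP [ab ac] bc].
have [ba cb ca] : [/\ b != a, c != b & c != a] by rewrite ![_ == a]eq_sym [c == b]eq_sym.
have r1 := w_equiv_BP_exchange (sgn E) (wf_diagram E) bc h3'.
have a2 : adj (relabel (swap (head_of b) (tail_of c)) (strand E)) (head_of a) (tail_of b).
  by apply: adj_relabel h2' _ _; rewrite /swap /= !xpair_eqE ?(negbTE ab) ?(negbTE bc) ?andbF.
have r2 := w_equiv_BP_exchange (sgn E) (w_equiv_wfr r1) ab a2.
have a3 : adj (relabel (swap (head_of a) (tail_of b)) (relabel (swap (head_of b) (tail_of c))
  (strand E)))
    (head_of c) (tail_of a).
  apply: (adj_relabel (h := swap (head_of a) (tail_of b)) (x := head_of c) (y := tail_of a));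
    [|by rewrite /swap /= !xpair_eqE ?(negbTE ca) ?(negbTE cb) ?andbF
     |by rewrite /swap /= !xpair_eqE ?(negbTE ab) ?andbF].
  by apply: adj_relabel h1' _ _; rewrite /swap /= !xpair_eqE ?(negbTE cb) ?(negbTE ac) ?andbF.
have r3 := w_equiv_BP_exchange (sgn E) (w_equiv_wfr r2) ca a3.
apply: w_equiv_trans (w_equiv_trans r1 (w_equiv_trans r2 r3)) _.
apply: w_equiv_ext; first exact: w_equiv_wfr r3.
  by move=> k; rewrite es /relabel -!map_comp.
have p : perm_eq (ends (strand E)) (ends (strand E')).
  rewrite (eq_ends es : ends (strand E') = ends (relabel (swaps _) (strand E))).
  apply: ends_swaps; first exact: wf_diagram.
  by rewrite /= !(adj_ends h1', adj_ends h2', adj_ends h3').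
have p' : perm_eq (ends (strand E)) (ends (relabel (swap (head_of c) (tail_of a))
  (relabel (swap (head_of a) (tail_of b)) (relabel (swap (head_of b) (tail_of c)) (strand E))))).
  apply: perm_trans p _; rewrite (@eq_ends _ _ (strand E')) //.
  by move=> k; rewrite es /relabel -!map_comp.
by move=> x; rewrite -(perm_mem p') => xs; rewrite eg.
Qed.

(** * Triangles *)

Section Triangle.
Variable n : nat.
Implicit Types (s : 'I_n -> seq endpoint) (g : nat -> bool) (e x y z : endpoint).

Definition other_end e : endpoint := (e.1, ~~ e.2).

Lemma pm1M3 (a b c : bool) : (pm1 a * pm1 b * pm1 c = pm1 (a (+) b (+) c))%R.
Proof. by case: a; case: b; case: c. Qed.

Lemma pm1N (a : bool) : (- pm1 a = pm1 (~~ a))%R.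
Proof. by case: a. Qed.

(** The three exchanges of R3 and [Delta] as a single map.  Arrows [a], [b], [c] join the
    portions p and q, q and t, t and p; the bits [da], [db], [dc] tell whether they point
    against this cyclic order, so that for instance [(a, da)] is the end of [a] on p. *)
Definition tri_map (a b c : nat) (da db dc : bool) e : endpoint :=
  if e.1 == a then (if e.2 == da then (c, ~~ dc) else (b, db))
  else if e.1 == b then (if e.2 == db then (a, ~~ da) else (c, dc))
  else if e.1 == c then (if e.2 == dc then (b, ~~ db) else (a, da))
  else e.

(** Taking into account whether an arrow follows the cyclic order of the portions makes the
    sign conditions of R3 and [Delta] one and the same condition, which is unchanged when
    an arrow is reversed and its sign changed.  The move is [Delta] if the three directions
    agree and R3 otherwise. *)
Lemma w_equiv_triangle s g a b c (da db dc : bool) : wf s -> uniq [:: a; b; c] ->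
  adj s (c, ~~ dc) (a, da) -> adj s (a, ~~ da) (b, db) -> adj s (b, ~~ db) (c, dc) ->
  let hp := prec s (c, ~~ dc) (a, da) in
  let hq := prec s (a, ~~ da) (b, db) in
  let ht := prec s (b, ~~ db) (c, dc) in
  g a (+) da (+) hp (+) hq = g b (+) db (+) hq (+) ht ->
  g b (+) db (+) hq (+) ht = g c (+) dc (+) ht (+) hp ->
  w_equiv Delta (s, g) (relabel (tri_map a b c da db dc) s, g).
Proof.
move=> hs u pp pq pt hp hq ht.
have hpC := precC hs pp; have hqC := precC hs pq; have htC := precC hs pt.
rewrite -/hp in hpC; rewrite -/hq in hqC; rewrite -/ht in htC.
move: (u); rewrite /= !inE negb_or andbT => /andP [/andP [/negbTE ab /negbTE ac] /negbTE bc].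
have [ba cb ca] : [/\ (b == a) = false, (c == b) = false & (c == a) = false].
  by rewrite ![_ == a]eq_sym [c == b]eq_sym.
(* The three pairs in the orders in which R3 and [Delta] list them. *)
have sw ps : ps \in [:: [:: ((c, ~~ dc), (a, da)); ((a, ~~ da), (b, db)); ((b, ~~ db), (c, dc))];
    [:: ((b, ~~ db), (c, dc)); ((c, ~~ dc), (a, da)); ((a, ~~ da), (b, db))];
    [:: ((a, ~~ da), (b, db)); ((b, ~~ db), (c, dc)); ((c, ~~ dc), (a, da))];
    [:: ((a, da), (c, ~~ dc)); ((c, dc), (b, ~~ db)); ((b, db), (a, ~~ da))];
    [:: ((c, dc), (b, ~~ db)); ((b, db), (a, ~~ da)); ((a, da), (c, ~~ dc))];
    [:: ((b, db), (a, ~~ da)); ((a, da), (c, ~~ dc)); ((c, dc), (b, ~~ db))]]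
  -> tri_map a b c da db dc =1 swaps ps.
  clear - ab ba ac ca bc cb.
  rewrite !inE => H; do 5 (try case/orP: H => H); move: H => /eqP ->;
    (move=> [i t]; rewrite /tri_map /swaps /= /swap /= !xpair_eqE;
    case: (i =P a) => [->|/eqP/negbTE ia];
      [|case: (i =P b) => [->|/eqP/negbTE ib]; [|case: (i =P c) => [->|/eqP/negbTE ic]]];
      move: t da db dc => [] [] [] [];
      by do 5 rewrite /= ?xpair_eqE ?eqxx ?ab ?ba ?ac ?ca ?bc ?cb ?ia ?ib ?ic).
have hs' : wf (relabel (tri_map a b c da db dc) s).
  pose ps := [:: ((c, ~~ dc), (a, da)); ((a, ~~ da), (b, db)); ((b, ~~ db), (c, dc))].
  apply: (@wf_eq _ (relabel (swaps ps) s)).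
    by move=> k; apply: eq_map => e; rewrite (sw ps) // !inE eqxx.
  by apply: wf_swaps => //=; rewrite (adj_ends pp) (adj_ends pq) (adj_ends pt).
have sk ps : tri_map a b c da db dc =1 swaps ps ->
   exchange ps (diagram_of g hs) (diagram_of g hs').
  by move=> e; split=> // k; apply: eq_map => x; rewrite e.
have pr x y : precedes (diagram_of g hs) x y = prec s x y by [].
have ad x y : adjacent (diagram_of g hs) x y = adj s x y by [].
move=> e1 e2; apply: (w_equiv_step (h := hs) (h' := hs')).
have SW ps : ps \in _ -> _ := fun h => sk ps (sw ps h).
have hpD : prec s (c, ~~ dc) (a, da) = hp by [].
have hqD : prec s (a, ~~ da) (b, db) = hq by [].
have htD : prec s (b, ~~ db) (c, dc) = ht by [].
have [pp' pq' pt'] : [/\ adj s (a, da) (c, ~~ dc), adj s (b, db) (a, ~~ da)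
    & adj s (c, dc) (b, ~~ db)] by rewrite adjC pp adjC pq adjC pt.
clearbody hp hq ht.
(* If the directions disagree, R3 starts at the portion that two arrows leave. *)
case: da db dc pp pq pt pp' pq' pt' hpC hqC htC hpD hqD htD e1 e2 hs' sk SW {sw} =>
    [] [] [] pp pq pt pp' pq' pt' hpC hqC htC hpD hqD htD e1 e2 hs' sk SW;
  [left; exists c, b, a|right; constructor 3; exists b, a, c|right; constructor 3; exists a, c, b
  |right; constructor 3; exists b, c, a|right; constructor 3; exists c, b, a
  |right; constructor 3; exists c, a, b|right; constructor 3; exists a, b, c|left; exists a, b, c];
 (split;
  [ by rewrite /= !inE ?ab ?ba ?ac ?ca ?bc ?cb
  | by rewrite !ad; split
  | by rewrite /eta /eps !pr /= ?hpC ?hqC ?htC ?hpD ?hqD ?htD !pm1M3 ?pm1N; congr pm1; move: e1 e2;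
       case: (g a) (g b) (g c) (hp) (hq) (ht) => [] [] [] [] [] []
  | by rewrite /eta /eps !pr /= ?hpC ?hqC ?htC ?hpD ?hqD ?htD !pm1M3 ?pm1N; congr pm1; move: e1 e2;
       case: (g a) (g b) (g c) (hp) (hq) (ht) => [] [] [] [] [] []
  | by apply: SW; rewrite !inE !eqxx ?orbT]).
Qed.
End Triangle.

(** * Sliding an end of an arrow along its strand *)

Section Slide.
Variable n : nat.
Implicit Types (s : 'I_n -> seq endpoint) (g : nat -> bool) (e x y z : endpoint).

Lemma prec_letter f s z x y : z \in ends s -> infix [:: x; y] (f z) -> prec (substitute f s) x y.
Proof.
case/endsP => k hz h; have [l [r sk]] : exists l r, s k = l ++ [:: z] ++ r.
  by case/splitPr: hz => l r; exists l, r.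
by apply: prec_substitute sk _ h; rewrite /subst_word /= cats0.
Qed.

(** The end [(a, da)] passes [(b, ~~ db)], which follows it.  The arrows [i1] and [i2] are
    inserted around the other ends of [a] and [b]; [d] tells whether their heads are at [a],
    and [c] on which side of [(b, db)] the end of [i1] falls. *)
Definition slide a b i1 i2 (da d db c : bool) e : seq endpoint :=
  if e == (a, da) then [:: (b, ~~ db)]
  else if e == (b, ~~ db) then [:: (a, da)]
  else if e == (a, ~~ da) then [:: (i1, d); (a, ~~ da); (i2, d)]
  else if e == (b, db) then
    if c then [:: (i1, ~~ d); (b, db); (i2, ~~ d)] else [:: (i2, ~~ d); (b, db); (i1, ~~ d)]
  else [:: e].

(** After the insertion and before the triangle move. *)
Let preslide a b i1 i2 (da d db c : bool) e : seq endpoint :=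
  if e == (a, ~~ da) then [:: (a, ~~ da); (i1, d); (i2, d)]
  else if e == (b, db) then
    if c then [:: (b, db); (i1, ~~ d); (i2, ~~ d)] else [:: (i2, ~~ d); (i1, ~~ d); (b, db)]
  else [:: e].

(** The sign of [i1] and the bit [c] are forced by the sign condition of the triangle formed
    by [a], [b] and [i1].  Both are unchanged when [a] is reversed and its sign changed. *)
Lemma w_equiv_slide s g k l m r a b i1 i2 (da d db : bool) : wf s ->
  s k = l ++ (a, da) :: (b, ~~ db) :: m ++ (a, ~~ da) :: r ->
  uniq [:: i1; i2] -> {in ends s, forall e, e.1 \notin [:: i1; i2]} ->
  g i1 = g b (+) ~~ db (+) d -> g i2 = ~~ g i1 ->
  w_equiv Delta (s, g) (substitute (slide a b i1 i2 da d db (g a (+) da (+) g b (+) db)) s, g).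
Proof.
move=> hs sk uy fresh gi1 gi2; set c := g a (+) _ (+) _ (+) _.
have cE : c = g a (+) da (+) g b (+) db by [].
clearbody c.
have i12 : (i1 == i2) = false by move: uy; rewrite /= inE andbT => /negbTE.
have i21 : (i2 == i1) = false by rewrite eq_sym.
have Pin : (a, da) \in ends s by apply: (mem_ends (k := k)); rewrite sk mem_cat inE eqxx orbT.
have xin : (b, ~~ db) \in ends s by apply: (mem_ends (k := k)); rewrite sk mem_cat !inE eqxx !orbT.
have Qin : (a, ~~ da) \in ends s.
  by apply: (mem_ends (k := k)); rewrite sk mem_cat !inE mem_cat inE eqxx !orbT.
have xbin : (b, db) \in ends s by move: (hs.2 b) xin; case: (db) => [] ->.
have ab : (a == b) = false.
  apply/eqP => ab; subst b; have := wf_uniq k hs; rewrite sk cat_uniq => /and3P [_ _ /=].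
  by rewrite !inE !mem_cat !inE !xpair_eqE !eqxx; case: (da) (db) => [] [];
    rewrite /= ?andbF ?orbT ?andbF.
have ba : (b == a) = false by rewrite eq_sym.
have ya z : z \in ends s -> ((z.1 == i1) = false) * ((z.1 == i2) = false).
  by move=> /fresh; rewrite !inE negb_or => /andP [/negbTE -> /negbTE ->].
have [ai1 ai2] := ya _ Pin; have [bi1 bi2] := ya _ xin; rewrite /= in ai1 ai2 bi1 bi2.
have [i1a i2a i1b i2b] : [/\ (i1 == a) = false, (i2 == a) = false,
  (i1 == b) = false & (i2 == b) = false].
  by rewrite ![_ == a]eq_sym ![_ == b]eq_sym.
pose s1 := substitute (preslide a b i1 i2 da d db c) s.
have w1 : wf s1.
  apply: (wf_substitute (X := [:: (a, ~~ da); (b, db)]) (N := [:: i1; i2])) => //.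
  - by rewrite /= inE xpair_eqE ab.
  - by move=> e; rewrite !inE => /orP [] /eqP ->.
  - by move=> e _; rewrite !inE negb_or /preslide => /andP [/negbTE -> /negbTE ->].
  - rewrite /subst_word /= /preslide eqxx xpair_eqE ba /= eqxx.
    by case: (c) (d) => [] []; count_letters.
have r1 : w_equiv Delta (s1, g) (s, g).
  have e : erase [:: i1; i2] s1 =1 s.
    move=> k'; rewrite [LHS](erase_substitute (f' := fun e => [:: e])); first exact: subst_word_id.
    move=> e es; rewrite /preslide; case: eqP => [->|_]; last case: eqP => [->|_].
    - by rewrite /= !inE ai1 ai2 !eqxx orbT.
    - by case: (c); rewrite /= !inE bi1 bi2 !eqxx !orbT.
    - by have [h1 h2] := ya _ es; rewrite /= !inE h1 h2.
  have aQ : adj s1 (i1, d) (i2, d).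
    by apply/orP; left; apply: (prec_letter (z := (a, ~~ da)));
      rewrite // /preslide eqxx /= !eqxx orbT.
  have aX : adj s1 (i1, ~~ d) (i2, ~~ d).
    rewrite /adj /s1; move: (c) => c'; apply/orP; case: c'; [left|right];
    by apply: (prec_letter (z := (b, db))); rewrite // /preslide xpair_eqE ba eqxx /= !eqxx ?orbT.
  apply: w_equiv_trans (w_equiv_R2 Delta (a := i1) (b := i2) (g := g) w1 _ _ _) _.
  - by rewrite gi2 negbK.
  - by case: (d) aQ aX.
  - by case: (d) aQ aX.
  - by apply: w_equiv_ext => //; apply: wf_erase.
apply: w_equiv_trans (w_equiv_sym r1) _.
have pp : prec s1 (a, da) (b, ~~ db).
  apply: (@prec_substitute _ _ s k l [:: (a, da);
    (b, ~~ db)] (m ++ (a, ~~ da) :: r) [:: (a, da); (b, ~~ db)]) => //.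
    rewrite /subst_word /= /preslide !xpair_eqE !ba !ab !eqxx /=.
    by case: (da) (db) => [] [].
  by rewrite /= !eqxx.
have pq : prec s1 (a, ~~ da) (i1, d).
  by apply: (prec_letter (z := (a, ~~ da))) => //; rewrite /preslide eqxx /= !eqxx.
have pt : if c then prec s1 (b, db) (i1, ~~ d) else prec s1 (i1, ~~ d) (b, db).
  have eb : preslide a b i1 i2 da d db c (b, db) =
    if c then [:: (b, db); (i1, ~~ d); (i2, ~~ d)] else [:: (i2, ~~ d); (i1, ~~ d); (b, db)].
   by rewrite /preslide eqxx xpair_eqE ba.
  by rewrite /s1; move: eb; case: (c) => eb; apply: (prec_letter (z := (b, db)));
    rewrite // eb /= !eqxx ?orbT.
have pt' : prec s1 (i1, ~~ d) (b, db) = ~~ c.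
  case: (c) pt => // pt; by rewrite (precC w1 (x := (b, db))) ?pt // /adj pt.
have at_ : adj s1 (i1, ~~ d) (b, db).
  by rewrite /adj; case: (c) pt => ->; rewrite ?orbT.
have pp' : prec s1 (b, ~~ db) (a, da) = false.
  by rewrite (precC w1 (x := (a, da))) ?pp // /adj pp.
have r2 : w_equiv Delta (s1, g) (relabel (tri_map a i1 b da d db) s1, g).
  apply: w_equiv_triangle => //.
  - by rewrite /= !inE ai1 ab i1b.
  - by rewrite /adj pp orbT.
  - by rewrite /adj pq.
  - by rewrite pp' pq pt' gi1 cE; case: (g a) (g b) (da) (d) (db) => [] [] [] [] [].
  - by rewrite pp' pq pt' gi1 cE; case: (g a) (g b) (da) (d) (db) => [] [] [] [] [].
apply: w_equiv_trans (r2) _; apply: w_equiv_ext; [exact: w_equiv_wfr r2| |by []].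
have nP : ((a, da) == (a, ~~ da)) = false by rewrite xpair_eqE eqxx; case: (da).
have nX : ((b, ~~ db) == (b, db)) = false by rewrite xpair_eqE eqxx; case: (db).
have tP : tri_map a i1 b da d db (a, da) = (b, ~~ db) by rewrite /tri_map /= !eqxx.
have tX : tri_map a i1 b da d db (b, ~~ db) = (a, da).
  by rewrite /tri_map /= ba bi1 eqxx; case: (db).
have tQ : tri_map a i1 b da d db (a, ~~ da) = (i1, d).
  by rewrite /tri_map /= eqxx; case: (da).
have tB : tri_map a i1 b da d db (b, db) = (i1, ~~ d).
  by rewrite /tri_map /= ba bi1 !eqxx.
have t1 : tri_map a i1 b da d db (i1, d) = (a, ~~ da).
  by rewrite /tri_map /= i1a !eqxx.
have t1' : tri_map a i1 b da d db (i1, ~~ d) = (b, db).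
  by rewrite /tri_map /= i1a eqxx; case: (d).
have t2 u : tri_map a i1 b da d db (i2, u) = (i2, u).
  by rewrite /tri_map /= i2a i21 i2b.
apply: relabel_substitute => e es; rewrite /preslide /slide.
have [e1 _] := ya _ es.
case: (e =P (a, da)) => [->|/eqP eP].
  by rewrite nP xpair_eqE ab /= tP.
case: (e =P (b, ~~ db)) => [->|/eqP eX].
  by rewrite nX xpair_eqE ba /= tX.
case: (e =P (a, ~~ da)) => [_|/eqP eQ]; first by rewrite /= tQ t1 t2.
case: (e =P (b, db)) => [_|/eqP eB].
  by case: (c); rewrite /= tB t1' t2.
congr [:: _]; case: e es eP eX eQ eB e1 => e t _; rewrite !xpair_eqE /tri_map /= => eP eX eQ eB ->.
case: (e =P a) eP eQ => _ /=; first by case: (t) (da) => [] [].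
by case: (e =P b) eX eB => _ //=; case: (t) (db) => [] [].
Qed.
End Slide.

(** * Tails between the ends of a self-arrow *)

Section Loops.
Variable n : nat.
Implicit Types (s : 'I_n -> seq endpoint) (g : nat -> bool) (e x y z : endpoint)
  (l m r u v w : seq endpoint).

Definition set_strand s k w : 'I_n -> seq endpoint := fun j => if j == k then w else s j.

Lemma set_strandE s k w : set_strand s k w k = w. Proof. by rewrite /set_strand eqxx. Qed.
Lemma set_strand_id s k w : s k = w -> set_strand s k w =1 s.
Proof. by move=> <- j; rewrite /set_strand; case: eqP => [->|]. Qed.
Lemma set_strand_set s k w w' : set_strand (set_strand s k w) k w' =1 set_strand s k w'.
Proof. by move=> j; rewrite /set_strand; case: eqP. Qed.

Definition tails (w : seq endpoint) := all (fun e => ~~ e.2) w.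

Lemma w_equiv_set_strand M p s g k w : w_equiv M p (s, g) -> s k = w ->
  w_equiv M p (set_strand s k w, g).
Proof.
move=> h sk; apply: w_equiv_trans (h) _; apply: w_equiv_ext => //; first exact: (w_equiv_wfr h).
by move=> j; rewrite set_strand_id.
Qed.

Lemma w_equiv_swap_tails M s g k l r x y : wf s -> ~~ x.2 -> ~~ y.2 ->
  s k = l ++ x :: y :: r -> w_equiv M (s, g) (set_strand s k (l ++ y :: x :: r), g).
Proof.
case: x => a []; case: y => b [] //= hs _ _ sk.
have ab : prec s (tail_of a) (tail_of b).
  by apply/existsP; exists k; apply/infixP; exists l, r; rewrite sk.
apply: w_equiv_trans (w_equiv_OC M g hs (_ : adj s (tail_of a) (tail_of b))) _.
  by rewrite /adj ab.
have [ain bin] := prec_ends ab.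
apply: w_equiv_ext => //; first by apply: wf_swaps => //=; rewrite ain bin.
have fix_word w : tail_of a \notin w -> tail_of b \notin w ->
    map (swap (tail_of a) (tail_of b)) w = w.
  move=> aw bw; rewrite -[RHS]map_id; apply/eq_in_map => e ew /=.
  rewrite /swap /=; case: eqP => [ea|_]; first by rewrite -ea ew in aw.
  by case: eqP => // eb; rewrite -eb ew in bw.
move=> j; rewrite /relabel /set_strand; case: (j =P k) => [->|/eqP jk].
  have := wf_uniq k hs; rewrite sk cat_uniq => /and3P [_ /hasPn h /=].
  rewrite inE negb_or -andbA; case/and4P => ab' ar br _.
  have al : tail_of a \notin l by apply: h; rewrite inE eqxx.
  have bl : tail_of b \notin l by apply: h; rewrite !inE eqxx orbT.
  rewrite map_cat /= !fix_word // /swap /= eqxx; congr (_ ++ _ :: _ :: _).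
  by rewrite eq_sym (negbTE ab') eqxx.
have off e : e \in s k -> e \notin s j.
  by move=> ek; apply: contraNN jk => ej; rewrite (wf_strand hs ej ek).
by apply: fix_word; apply: off; rewrite sk mem_cat !inE eqxx ?orbT.
Qed.

Lemma w_equiv_tail_left M s g k l u r x : wf s -> tails u -> ~~ x.2 ->
  s k = l ++ u ++ x :: r -> w_equiv M (s, g) (set_strand s k (l ++ x :: u ++ r), g).
Proof.
elim: u l => [|y u IH] l hs /=; first by move=> _ _ sk; apply: w_equiv_set_strand => //;
  apply: w_equiv_refl.
case/andP => ty tu tx sk.
have r1 := IH (rcons l y) hs tu tx _; rewrite cat_rcons in r1; have {}r1 := r1 sk.
rewrite cat_rcons in r1; apply: w_equiv_trans (r1) _.
apply: w_equiv_trans (w_equiv_swap_tails M g (w_equiv_wfr r1) ty tx (set_strandE _ _ _)) _.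
apply: w_equiv_ext => //; last by move=> j; rewrite set_strand_set.
exact: w_equiv_wfr (w_equiv_swap_tails M g (w_equiv_wfr r1) ty tx (set_strandE _ _ _)).
Qed.

Lemma w_equiv_tail_blocks M s g k l u v r : wf s -> tails u -> tails v ->
  s k = l ++ u ++ v ++ r -> w_equiv M (s, g) (set_strand s k (l ++ v ++ u ++ r), g).
Proof.
elim: v s l => [|y v IH] s l hs tu /=; first by move=> _ sk; apply: w_equiv_set_strand => //;
  apply: w_equiv_refl.
case/andP => ty tv sk.
have r1 := w_equiv_tail_left M g hs tu ty sk.
apply: w_equiv_trans (r1) _.
have r2 := IH (set_strand s k (l ++ y :: u ++ v ++ r)) (rcons l y) (w_equiv_wfr r1) tu tv _.
rewrite set_strandE !cat_rcons in r2; have {}r2 := r2 erefl.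
apply: w_equiv_trans (r2) _; apply: w_equiv_ext => //; first exact: w_equiv_wfr r2.
by move=> j; rewrite set_strand_set.
Qed.

Lemma w_equiv_tails M s g k l u v r : wf s -> tails u -> perm_eq u v ->
  s k = l ++ u ++ r -> w_equiv M (s, g) (set_strand s k (l ++ v ++ r), g).
Proof.
move=> hs tu uv sk.
pose P v := tails v /\ w_equiv M (s, g) (set_strand s k (l ++ v ++ r), g).
suff: P v by case.
apply: (catCA_perm_ind _ uv); last first.
  by split=> //; apply: w_equiv_set_strand => //; apply: w_equiv_refl.
move=> u1 u2 u3 [t h]; move: t; rewrite /tails !all_cat => /and3P [t1 t2 t3].
split; first by rewrite /tails !all_cat t1 t2 t3.
have e : set_strand s k (l ++ (u1 ++ u2 ++ u3) ++ r) k = l ++ u1 ++ u2 ++ u3 ++ r.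
  by rewrite set_strandE -!catA.
have hb := w_equiv_tail_blocks M g (w_equiv_wfr h) t1 t2 e.
apply: w_equiv_trans (h) (w_equiv_trans (hb) _); apply: w_equiv_ext => //;
  first exact: w_equiv_wfr hb.
by move=> j; rewrite set_strand_set -!catA.
Qed.

(** The end of [a] that is a tail is brought next to the other one. *)
Lemma w_equiv_remove_loop M s g k l u r a da : wf s -> tails u ->
  s k = l ++ (a, da) :: u ++ (a, ~~ da) :: r -> w_equiv M (s, g) (erase [:: a] s, g).
Proof.
move=> hs tu sk.
suff [v [r1 h]] : exists v, w_equiv M (s, g) (set_strand s k v, g) /\
   [/\ adj (set_strand s k v) (tail_of a) (head_of a) &
      [seq e <- v | e.1 \notin [:: a]] = [seq e <- s k | e.1 \notin [:: a]]].
  case: h => ad dv; apply: w_equiv_trans (r1) _.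
  apply: w_equiv_trans (w_equiv_R1 M g (w_equiv_wfr r1) ad) _; apply: w_equiv_ext => //.
    exact: wf_erase (w_equiv_wfr r1).
  by move=> j; rewrite /erase /set_strand /=; case: (j =P k) => [->|];
    rewrite ?eqxx ?dv // => /eqP /negbTE ->.
case: da sk => sk.
- exists (l ++ (a, true) :: (a, false) :: u ++ r); split; last split.
  + rewrite -cat_rcons; apply: (@w_equiv_tail_left M s g k _ u r (a, false)) => //.
    by rewrite cat_rcons.
  + apply/orP; right; apply/existsP; exists k; rewrite set_strandE.
    by apply/infixP; exists l, (u ++ r).
  + by rewrite sk !filter_cat /= !inE !eqxx !filter_cat /= !inE !eqxx.
- exists (l ++ (u ++ [:: (a, false)]) ++ (a, true) :: r); split; last split.
  + apply: (@w_equiv_tails M s g k _ ((a, false) :: u)) => //.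
    by rewrite cats1 perm_sym perm_rcons.
  + apply/orP; left; apply/existsP; exists k; rewrite set_strandE.
    by apply/infixP; exists (l ++ u), r; rewrite -!catA.
  + by rewrite sk !filter_cat /= !inE !eqxx !filter_cat /= !inE !eqxx cats0.
Qed.
End Loops.

(** * Delta realizes self-crossing changes *)

Section SC.
Variable n : nat.
Implicit Types (s : 'I_n -> seq endpoint) (g : nat -> bool) (e x y z : endpoint)
  (l m r u v w : seq endpoint).

(** Passing an end whose other end is in [w] makes [w] longer; the second term compensates
    for it. *)
Definition loop_measure w := (size w + count (fun e => other_end e \in w) w)%N.

Lemma slide_flip a b i1 i2 (da d db c : bool) e : a \notin [:: b; i1; i2] ->
  slide a b i1 i2 (~~ da) d db c (flip [:: a] e) =
  map (flip [:: a]) (slide a b i1 i2 da d db c e).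
Proof.
rewrite !inE !negb_or => /and3P [/negbTE ab /negbTE a1 /negbTE a2].
have [ba i1a i2a] : [/\ (b == a) = false, (i1 == a) = false & (i2 == a) = false].
  by rewrite ![_ == a]eq_sym.
case: e => e t; rewrite /slide /flip /= !inE !xpair_eqE.
case: (e =P a) => [->|/eqP/negbTE ea] /=.
  rewrite ?eqxx ?ab /=.
  by case: t da => [] []; rewrite /= !inE ?eqxx ?ba ?i1a ?i2a.
case: ifP => _ /=; first by rewrite !inE eqxx.
case: ifP => _ /=; last by rewrite !inE ea.
by case: c; rewrite /= !inE ba i1a i2a.
Qed.

Lemma loop_labels s k l w r a da e : wf s -> s k = l ++ (a, da) :: w ++ (a, ~~ da) :: r ->
  e \in l ++ w ++ r -> e.1 != a.
Proof.
move=> hs sk el; apply/eqP => ea.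
have : perm_eq (s k) ((a, da) :: (a, ~~ da) :: (l ++ w ++ r)).
  by rewrite sk; apply/permP => P; rewrite /= !count_cat /= !count_cat /=; lia.
move/perm_uniq; rewrite (wf_uniq k hs) /= inE negb_or.
case: e ea el => e t /= ->; case: t da {sk} => [] [] el; rewrite el ?andbF //=.
Qed.

Lemma flip_word a w : {in w, forall e, e.1 != a} -> map (flip [:: a]) w = w.
Proof.
move=> h; rewrite -[RHS]map_id; apply/eq_in_map => -[e t] /h /=.
by rewrite /flip /= inE => /negbTE ->.
Qed.

Lemma flip_loop s k l w r a da : wf s -> s k = l ++ (a, da) :: w ++ (a, ~~ da) :: r ->
  relabel (flip [:: a]) s k = l ++ (a, ~~ da) :: w ++ (a, da) :: r.
Proof.
move=> hs sk; rewrite /relabel sk map_cat /= map_cat /=.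
rewrite !flip_word /flip /= ?inE ?eqxx ?negbK // => e he;
  by apply: (loop_labels hs sk); rewrite !mem_cat he ?orbT.
Qed.

Lemma fresh_signs s g (i1 i2 : nat) (b1 b2 : bool) : wf s -> uniq [:: i1; i2] ->
  {in ends s, forall e, e.1 \notin [:: i1; i2]} ->
  exists g', [/\ same_signs s g g', g' i1 = b1 & g' i2 = b2].
Proof.
move=> hs u fr; exists (fun c => if c == i1 then b1 else if c == i2 then b2 else g c).
move: u; rewrite /= inE andbT => /negbTE i12; split; last 2 first.
- by rewrite eqxx.
- by rewrite eq_sym i12 eqxx.
by move=> c /fr; rewrite !inE negb_or => /andP [/negbTE -> /negbTE ->].
Qed.

Lemma leq_count_in (p q : pred endpoint) w :
  {in w, forall e, p e -> q e} -> (count p w <= count q w)%N.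
Proof.
elim: w => //= e w IH h; apply: leq_add; last by apply: IH => z zw; apply: h; rewrite inE zw orbT.
by have := h e (mem_head _ _); case: (p e) => // ->.
Qed.

(** If the other end of the end that is passed lies in [m], it is replaced by three letters
    none of which has its other end in the new word. *)
Lemma loop_measure_slide m a b i1 i2 (da d db c : bool) :
  uniq [:: (a, da), (b, ~~ db), (a, ~~ da) & m] ->
  {in (b, ~~ db) :: m, forall e, e.1 \notin [:: i1; i2]} ->
  (loop_measure (subst_word (slide a b i1 i2 da d db c) m) < loop_measure ((b, ~~ db) :: m))%N.
Proof.
set x := (b, ~~ db); set f := slide _ _ _ _ _ _ _ _ => ua fr.
move: ua; rewrite /= !inE !negb_or => /and4P [/and3P [_ _ Pm] /andP [_ xm] Qm um].
have fid e : e \in m -> e != (b, db) -> f e = [:: e].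
  move=> em /negbTE eB; rewrite /f /slide eB.
  case: eqP => [eP|_]; first by rewrite -eP em in Pm.
  case: eqP => [eX|_]; first by rewrite /x -eX em in xm.
  by case: eqP => [eQ|_ //]; rewrite -eQ em in Qm.
have barx : other_end (b, db) = x by [].
have barxx : other_end x = (b, db) by rewrite /other_end /= negbK.
case bm: ((b, db) \in m); last first.
  have -> : subst_word f m = m.
    by apply: subst_word_id => e em; apply: fid => //; apply: contraFN bm => /eqP <-.
  rewrite /loop_measure /= addSn ltnS leq_add2l; apply: leq_trans (leq_addl _ _).
  by apply: sub_count => e; rewrite inE => ->; rewrite orbT.
have {}bm := bm; move: um xm Pm Qm fr fid; case/splitPr: bm => v1 v2 um xm Pm Qm fr fid.
have [B1 B2] : (b, db) \notin v1 /\ (b, db) \notin v2.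
  move: um; rewrite cat_uniq => /and3P [_ /hasPn h /= /andP [-> _]]; split=> //.
  by apply: h; rewrite inE eqxx.
have fB : f (b, db) = if c then [:: (i1, ~~ d); (b, db); (i2, ~~ d)] else [:: (i2, ~~ d);
  (b, db); (i1, ~~ d)].
  have Bm : (b, db) \in v1 ++ (b, db) :: v2 by rewrite mem_cat inE eqxx orbT.
  rewrite /f /slide eqxx; case: eqP => [eP|_]; first by rewrite -eP Bm in Pm.
  case: eqP => [eX|_]; first by rewrite /x -eX Bm in xm.
  by case: eqP => [eQ|_ //]; rewrite -eQ Bm in Qm.
have ex1 : subst_word f v1 = v1.
  by apply: subst_word_id => e ev; apply: fid; [rewrite mem_cat ev|apply: contraNN B1 => /eqP <-].
have ex2 : subst_word f v2 = v2.
  by apply: subst_word_id => e ev; apply: fid;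
    [rewrite mem_cat inE ev !orbT|apply: contraNN B2 => /eqP <-].
set W := subst_word f _.
have WE : W = v1 ++ f (b, db) ++ v2 by rewrite /W subst_word_cat ex1 -cat1s subst_word_cat ex2
  /subst_word /= cats0.
have lab e : e \in v1 ++ (b, db) :: v2 -> (e.1 == i1) = false /\ (e.1 == i2) = false.
  by move=> ev; have := fr e; rewrite inE ev orbT => /(_ isT);
    rewrite !inE negb_or => /andP [/negbTE -> /negbTE ->].
have memW e : e \in W -> [\/ e \in v1 ++ (b, db) :: v2, e = (i1, ~~ d) | e = (i2, ~~ d)].
  rewrite WE fB !mem_cat inE; case/or3P => [ev|ef|ev].
  - by constructor 1; rewrite ev.
  - by move: ef; case: (c); rewrite !inE => /or3P [] /eqP ->; rewrite ?eqxx ?orbT;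
      by [constructor 1|constructor 2|constructor 3].
  - by constructor 1; rewrite ev !orbT.
have barW i : i \in [:: i1; i2] -> (i, d) \notin W.
  move=> ii; apply/negP => /memW [/lab [] /= h1 h2|[_]|[_]].
  - by move: ii; rewrite !inE h1 h2.
  - by case: (d).
  - by case: (d).
have xW : x \notin W.
  apply/negP => /memW [xv|[e1 _]|[e1 _]]; first by rewrite xv in xm.
  - have := lab (b, db); rewrite mem_cat inE eqxx orbT /= e1 eqxx => -[] //.
  - have := lab (b, db); rewrite mem_cat inE eqxx orbT /= e1 eqxx => -[] //.
have sub v : {subset v <= v1 ++ (b, db) :: v2} ->
  (count (fun e => other_end e \in W) v <= count (fun e => other_end e \in x :: v1 ++ (b,
    db) :: v2) v)%N.
  move=> sv; apply: leq_count_in => e /sv /lab [h1 h2] /memW [ev|[e1 _]|[e1 _]].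
  - by rewrite inE ev orbT.
  - by rewrite e1 eqxx in h1.
  - by rewrite e1 eqxx in h2.
have l1 : (count (fun e => other_end e \in W) v1 <= count (fun e => other_end e \in x :: v1 ++
  (b, db) :: v2) v1)%N.
  by apply: sub => e ev; rewrite mem_cat ev.
have l2 : (count (fun e => other_end e \in W) v2 <= count (fun e => other_end e \in x :: v1 ++
  (b, db) :: v2) v2)%N.
  by apply: sub => e ev; rewrite mem_cat inE ev !orbT.
have cB : count (fun e => other_end e \in W) (f (b, db)) = 0%N.
  have b1 : other_end (i1, ~~ d) \notin W by rewrite /other_end /= negbK barW // inE eqxx.
  have b2 : other_end (i2, ~~ d) \notin W by rewrite /other_end /= negbK barW // !inE eqxx orbT.
  by rewrite fB; case: (c); rewrite /= barx (negbTE b1) (negbTE b2) (negbTE xW).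
have sB : size (f (b, db)) = 3 by rewrite fB; case: (c).
have h1 : other_end x \in x :: v1 ++ (b, db) :: v2 by rewrite barxx inE mem_cat inE eqxx !orbT.
have h2 : other_end (b, db) \in x :: v1 ++ (b, db) :: v2 by rewrite barx inE eqxx.
have -> : loop_measure W = (size v1 + 3 + size v2 + (count (fun e => other_end e \in W) v1
    + count (fun e => other_end e \in W) v2))%N.
  have cW q : count q W = (count q v1 + (count q (f (b,
    db)) + count q v2))%N by rewrite WE !count_cat.
  have sW : size W = (size v1 + 3 + size v2)%N by rewrite WE !size_cat sB addnA.
  by rewrite /loop_measure cW cB sW add0n.
have cX q : count q (x :: v1 ++ (b, db) :: v2) = (q x + (count q v1 + (q (b, db) + count q v2)))%N.
  by rewrite /= count_cat.
rewrite /loop_measure cX h1 h2 /= size_cat /=.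
move: l1 l2; move: (count _ v1) (count _ v1) (count _ v2) (count _ v2) (size v1) (size v2).
by clear; lia.
Qed.

(** The same arrows are inserted, with the same signs, before and after reversing [a]. *)
Lemma slide_both s g k l m r a b (da d db : bool) : wf s ->
  s k = l ++ (a, da) :: (b, ~~ db) :: m ++ (a, ~~ da) :: r ->
  exists i1 i2 c g', let sl := slide a b i1 i2 da d db c in
  [/\ uniq [:: i1; i2], {in ends s, forall e, e.1 \notin [:: i1; i2]},
      substitute sl s k = (subst_word sl l ++ [:: (b, ~~ db)]) ++ (a, da) :: subst_word sl m ++
                      (i1, d) :: (a, ~~ da) :: (i2, d) :: subst_word sl r,
      w_equiv Delta (s, g) (substitute sl s, g') &
      w_equiv Delta (relabel (flip [:: a]) s, toggle [:: a] g)
                (relabel (flip [:: a]) (substitute sl s), toggle [:: a] g')].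
Proof.
move=> hs sk; have [L [sL ui fr]] := fresh_labels (ends s) 2.
case: L sL ui fr => [//|i1 [//|i2 [|//]]] _ ui fr.
have [g' [gg' g1 g2]] := @fresh_signs s g i1 i2 (g b (+) ~~ db (+) d)
  (~~ (g b (+) ~~ db (+) d)) hs ui fr.
have sk' : s k = l ++ (a, da) :: ((b, ~~ db) :: m) ++ (a, ~~ da) :: r by rewrite sk.
have ain : (a, da) \in ends s by apply: (mem_ends (k := k)); rewrite sk mem_cat inE eqxx orbT.
have xin : (b, ~~ db) \in ends s by apply: (mem_ends (k := k)); rewrite sk mem_cat !inE eqxx !orbT.
have ba : b != a.
  by apply: (loop_labels (e := (b, ~~ db)) hs sk'); rewrite mem_cat inE eqxx orbT.
have ta : tail_of a \in ends s by move: (hs.2 a) ain; case: (da) => [] ->.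
have tb : tail_of b \in ends s by move: (hs.2 b) xin; case: (db) => [] //= ->.
have [ia ib] := (fr _ ain, fr _ xin).
have anot : a \notin [:: b; i1; i2] by rewrite inE negb_or eq_sym ba.
pose c := g' a (+) da (+) g' b (+) db.
exists i1, i2, c, g'; split => //.
- have nP : (~~ da == da) = false by case: (da).
  rewrite /substitute sk subst_word_cat -catA; congr (_ ++ _).
  rewrite -[(a, da) :: _]cat1s -[(b, ~~ db) :: m ++ _]cat1s -[(a, ~~ da) :: r]cat1s !subst_word_cat.
  by rewrite /subst_word /= /slide !xpair_eqE (negbTE ba) !eqxx /= nP [a == b]eq_sym (negbTE ba).
- have r0 : w_equiv Delta (s, g) (s, g') by apply: w_equiv_ext.
  apply: w_equiv_trans (r0) _; apply: (w_equiv_slide hs sk ui fr).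
  + by rewrite g1 gg'.
  + by rewrite g2 g1.
have hf := wf_flip [:: a] hs.
have tg : same_signs (relabel (flip [:: a]) s) (toggle [:: a] g) (toggle [:: a] g').
  move=> i; rewrite ends_relabel => /mapP [[j t] js [-> _]]; rewrite /toggle.
  rewrite gg' //; by move: (hs.2 j) js; case: t => ->.
have r0 : w_equiv Delta (relabel (flip [:: a]) s, toggle [:: a] g) (relabel (flip [:: a]) s,
  toggle [:: a] g').
  by apply: w_equiv_ext.
apply: w_equiv_trans (r0) _.
have fk := flip_loop hs sk'; rewrite -[in X in _ ++ _ :: _ ++ X :: _](negbK da) in fk.
have frf : {in ends (relabel (flip [:: a]) s), forall e, e.1 \notin [:: i1; i2]}.
  by move=> e; rewrite ends_relabel => /mapP [f fs ->]; apply: (fr f).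
have [tga tgb] : toggle [:: a] g' a = ~~ g' a /\ toggle [:: a] g' b = g' b.
  by rewrite /toggle !inE eqxx (negbTE ba).
have [tg1 tg2] : toggle [:: a] g' i1 = g' i1 /\ toggle [:: a] g' i2 = g' i2.
  move: anot; rewrite /toggle !inE !negb_or ![a == _]eq_sym => /and3P [_ /negbTE -> /negbTE -> //].
have r1 := w_equiv_slide (g := toggle [:: a] g') (d := d) hf fk ui frf.
rewrite tga tgb tg1 tg2 in r1; have {}r1 := r1 _ _.
have ce : ~~ g' a (+) ~~ da (+) g' b (+) db = c by rewrite /c addNb addbN negbK.
rewrite ce in r1.
have {}r1 : w_equiv Delta (relabel (flip [:: a]) s, toggle [:: a] g')
   (substitute (slide a b i1 i2 (~~ da) d db c) (relabel (flip [:: a]) s), toggle [:: a] g').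
  by apply: r1; [rewrite g1 gg'|rewrite g2 g1].
apply: w_equiv_trans (r1) _; apply: w_equiv_ext => //; first exact: w_equiv_wfr r1.
move=> j; rewrite /substitute /relabel map_subst_word /subst_word -map_comp; congr flatten.
by apply: eq_map => e; apply: slide_flip.
Qed.

(** Once the tail of [i] has passed the tails of [u], the arrow [i] is a curl. *)
Lemma w_equiv_drop_curl s g k l w u r a i (da : bool) : wf s -> tails u -> (i, false) \in u ->
  s k = l ++ (a, da) :: w ++ u ++ (i, true) :: (a, ~~ da) :: r ->
  let s' := set_strand s k (l ++ (a, da) :: w ++ rcons (rem (i, false) u) (i, false)
                       ++ (i, true) :: (a, ~~ da) :: r) in
  wf s' /\ w_equiv Delta (s, g) (erase [:: i] s', g).
Proof.
move=> hs tu iu sk.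
have r1 : w_equiv Delta (s, g) (set_strand s k (l ++ (a, da) :: w ++ rcons (rem (i,
  false) u) (i, false)
     ++ (i, true) :: (a, ~~ da) :: r), g).
  rewrite -cat_cons catA; apply: (@w_equiv_tails _ _ s g k (l ++ (a, da) :: w) u) => //.
    by rewrite (perm_trans (perm_to_rem iu)) // perm_sym perm_rcons.
  by rewrite sk -catA.
move=> s'; split; first exact: w_equiv_wfr r1.
apply: w_equiv_trans (r1) _; apply: w_equiv_R1; first exact: w_equiv_wfr r1.
apply/orP; left; apply/existsP; exists k; rewrite set_strandE; apply/infixP.
exists (l ++ (a, da) :: w ++ rem (i, false) u), ((a, ~~ da) :: r).
by rewrite -cats1 -!catA /= -!catA.
Qed.

(** The loop consists of a word [x :: w] that remains to be passed and of a word [u] of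
    tails.  The first end of [a] is slid past [x], in the diagram and in its reversal. *)
Lemma loop_step s g k l x w u r a da : wf s -> tails u ->
  s k = l ++ (a, da) :: (x :: w) ++ u ++ (a, ~~ da) :: r ->
  exists s' g' l' w' u' r',
    [/\ w_equiv Delta (s, g) (s', g'),
       w_equiv Delta (relabel (flip [:: a]) s, toggle [:: a] g) (relabel (flip [:: a]) s',
         toggle [:: a] g'),
       s' k = l' ++ (a, da) :: w' ++ u' ++ (a, ~~ da) :: r', tails u' &
       (loop_measure w' < loop_measure (x :: w))%N].
Proof.
case: x => b xi; pose db := ~~ xi; have -> : xi = ~~ db by rewrite /db negbK.
move: db => db {xi} hs tu sk0.

have sk : s k = l ++ (a, da) :: (b, ~~ db) :: (w ++ u) ++ (a, ~~ da) :: r by rewrite sk0 /= -!catA.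
have uQ : uniq [:: (a, da), (b, ~~ db), (a, ~~ da) & w ++ u].
  have := wf_uniq k hs; rewrite sk cat_uniq => /and3P [_ _ H].
  have : uniq ((a, da) :: (b, ~~ db) :: (a, ~~ da) :: (w ++ u) ++ r).
    rewrite -(perm_uniq (s1 := (a, da) :: (b, ~~ db) :: (w ++ u) ++ (a, ~~ da) :: r)) //.
    by apply/permP => P; rewrite /= !count_cat /=; lia.
  by rewrite -[_ :: _ :: _ :: _ ++ _]/([:: (a, da), (b, ~~ db), (a,
    ~~ da) & w ++ u] ++ r) cat_uniq => /and3P [].
have uw : uniq [:: (a, da), (b, ~~ db), (a, ~~ da) & w].
  by move: uQ; rewrite -[_ :: _ :: _ :: _ ++ _]/([:: (a, da), (b, ~~ db), (a,
    ~~ da) & w] ++ u) cat_uniq => /and3P [].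
have notin e : e \in w ++ u -> [/\ (e == (a, da)) = false, (e == (b,
  ~~ db)) = false & (e == (a, ~~ da)) = false].
  move=> em; move: uQ; rewrite /= !inE !negb_or => /and4P [/and3P [_ _ h1] /andP [_ h2] h3 _].
  by split; apply/negbTE; apply: contraTneq em => ->.
(* The new arrows get their tails in front of [(a, ~~ da)], unless the other end of [b] is one
   of the tails of [u]: then they get their heads there, and tails near [(b, db)]. *)
have [i1 [i2 [c [g' /=]]]] := @slide_both s g k l (w ++ u) r a b da ((b, db) \in u) db hs sk.
set sl := slide _ _ _ _ _ _ _ _; case=> ui fr sk1 r1 r2.
have frw : {in (b, ~~ db) :: w, forall e, e.1 \notin [:: i1; i2]}.
  move=> e ew; apply: fr; apply: (mem_ends (k := k)); move: ew.
  by rewrite sk mem_cat !inE !mem_cat => /orP [] ->; rewrite !orbT.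
have mw := loop_measure_slide ((b, db) \in u) c uw frw; rewrite -/sl in mw.
have slid e : e \in w ++ u -> e != (b, db) -> sl e = [:: e].
  by move=> /notin [h1 h2 h3] /negbTE h4; rewrite /sl /slide h1 h2 h3 h4.
case bu : ((b, db) \in u); rewrite bu in sk1; last first.
  exists (substitute sl s), g', (subst_word sl l ++ [:: (b, ~~ db)]), (subst_word sl w),
    (rcons u (i1, false)), ((i2, false) :: subst_word sl r).
  split=> //; last by rewrite /tails all_rcons.
  rewrite sk1 subst_word_cat (subst_word_id (w := u)) ?cat_rcons -?catA //.
  by move=> e eu; apply: slid; [rewrite mem_cat eu orbT|apply: contraFneq bu => <-].
(* The tail of [i1] lands in [u] and its head next to [(a, ~~ da)], so [i1] can be removed. *)
have dbf : db = false by move/allP: tu => /(_ _ bu) /negbTE.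
have um : uniq (w ++ u) by move: uQ => /= /and4P [].
have wid : subst_word sl w = w.
  apply: subst_word_id => e ew; apply: slid; first by rewrite mem_cat ew.
  move: um; rewrite cat_uniq => /and3P [_ /hasPn h _]; apply: contraTneq ew => ->; exact: h.
have slB : sl (b, db) = if c then [:: (i1, false); (b, db); (i2, false)] else [:: (i2, false);
  (b, db); (i1, false)].
  by have [|h1 h2 h3] := notin (b, db); rewrite ?mem_cat ?bu ?orbT // /sl /slide h1 h2 h3 eqxx bu.
have tx : tails (subst_word sl u).
  apply/allP => z /flattenP [_ /mapP [e eu ->]]; case: (eqVneq e (b, db)) => [->|eb].
    by rewrite slB dbf; case: (c); rewrite !inE => /or3P [] /eqP ->.
  rewrite slid ?mem_cat ?eu ?orbT // inE => /eqP ->; exact: (allP tu).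
have ix : (i1, false) \in subst_word sl u.
  apply/flattenP; exists (sl (b, db)); first by apply/mapP; exists (b, db).
  by rewrite slB; case: (c); rewrite !inE eqxx ?orbT.
pose l' := subst_word sl l ++ [:: (b, ~~ db)]; pose r' := (i2, true) :: subst_word sl r.
have {}sk1 : substitute sl s k = l' ++ (a, da) :: w ++ subst_word sl u ++ (i1, true) :: (a,
  ~~ da) :: r'.
  by rewrite sk1 subst_word_cat wid -!catA.
have fin_ : (b, db) \in ends s by apply: (mem_ends (k := k)); rewrite sk !(mem_cat, inE) bu !orbT.
have ain : (a, da) \in ends s by apply: (mem_ends (k := k)); rewrite sk mem_cat inE eqxx orbT.
have ai : a != i1 by move: (fr _ ain); rewrite inE negb_or => /andP [].
pose u' := rem (i1, false) (subst_word sl u).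
pose word t := l' ++ (a, t) :: w ++ rcons u' (i1, false) ++ (i1, true) :: (a, ~~ t) :: r'.
have /= [wu s1] := w_equiv_drop_curl g' (w_equiv_wfr r1) tx ix sk1.
rewrite -/u' -/(word da) in wu s1.
have sk1' : substitute sl s k = l' ++ (a, da) :: (w ++ subst_word sl u ++ [:: (i1,
  true)]) ++ (a, ~~ da) :: r'.
  by rewrite sk1 -!catA.
have fk1 := flip_loop (w_equiv_wfr r1) sk1'.
have fk1' : relabel (flip [:: a]) (substitute sl s) k = l' ++ (a,
  ~~ da) :: w ++ subst_word sl u ++ (i1, true) :: (a, ~~ ~~ da) :: r'.
  by rewrite fk1 negbK -!catA.
have /= [_ s2] := w_equiv_drop_curl (toggle [:: a] g') (w_equiv_wfr r2) tx ix fk1'.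
rewrite -/u' -/(word (~~ da)) in s2.
pose q := fun e : endpoint => e.1 \notin [:: i1].
exists (erase [:: i1] (set_strand (substitute sl s) k (word da))), g',
  (filter q l'), (filter q w), (filter q u'), (filter q r'); split.
- exact: w_equiv_trans r1 s1.
- apply: w_equiv_trans r2 (w_equiv_trans (s2) _); apply: w_equiv_ext => //;
  first exact: w_equiv_wfr s2.
  move=> j; have -> : relabel (flip [:: a]) (erase [:: i1] (set_strand (substitute sl s) k
    (word da))) j =
      erase [:: i1] (relabel (flip [:: a]) (set_strand (substitute sl s) k (word da))) j.
    by rewrite /erase /relabel filter_map.
  rewrite /erase; congr filter; case: (j =P k) => [->|/eqP jk];
    last by rewrite /relabel /set_strand (negbTE jk).
  have uk : set_strand (substitute sl s) k (word da) k =
      l' ++ (a, da) :: (w ++ rcons u' (i1, false) ++ [:: (i1, true)]) ++ (a, ~~ da) :: r'.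
    by rewrite set_strandE /word -!catA.
  by rewrite set_strandE (flip_loop wu uk) /word negbK -!catA.
- rewrite /erase set_strandE /word; move: l' r' {wu s1 s2 fk1 fk1' sk1 sk1' word} => l1 r1'.
  by rewrite filter_cat /= inE ai !filter_cat filter_rcons /= !inE eqxx /= ai.
- by apply/allP => z; rewrite mem_filter => /andP [_ /mem_rem]; apply: (allP tx).
- have -> : filter q w = w.
    apply/all_filterP/allP => e ew; have := frw e; rewrite inE ew orbT => /(_ isT).
    by rewrite /q !inE negb_or => /andP [].
  by rewrite -[X in loop_measure X < _]wid.
Qed.

Lemma w_equiv_flip_loop N s g k l w u r a da : (loop_measure w < N)%N -> wf s -> tails u ->
  s k = l ++ (a, da) :: w ++ u ++ (a, ~~ da) :: r ->
  w_equiv Delta (s, g) (relabel (flip [:: a]) s, toggle [:: a] g).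
Proof.
elim: N s g l w u r => // N IH s g l [|x w] u r mw hs tu sk.
  have sk' : s k = l ++ (a, da) :: u ++ (a, ~~ da) :: r by [].
  apply: w_equiv_trans (w_equiv_remove_loop Delta g hs tu sk') _; apply: w_equiv_sym.
  have fk := flip_loop hs sk'; rewrite -[in X in _ ++ _ :: _ ++ X :: _](negbK da) in fk.
  have h := w_equiv_remove_loop Delta (toggle [:: a] g) (wf_flip _ hs) tu fk.
  apply: w_equiv_trans (h) _; apply: w_equiv_ext; first exact: w_equiv_wfr h.
    move=> j; rewrite /erase /relabel filter_map /= -[RHS]map_id.
    rewrite (eq_filter (a2 := fun e => e.1 \notin [:: a])) //.
    apply/eq_in_map => -[e t]; rewrite mem_filter /flip /= => /andP [/negbTE -> //].
  move=> c; rewrite ends_erase mem_filter /toggle /= => /andP [/negbTE ->] //.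
have [s' [g' [l' [w' [u' [r' [h1 h2 sk' tu' mw']]]]]]] := loop_step g hs tu sk.
apply: w_equiv_trans (h1) (w_equiv_trans _ (w_equiv_sym h2)).
by apply: IH sk' => //; [move: mw' mw; lia|exact: w_equiv_wfr h1].
Qed.

End SC.

Theorem Delta_generates_SC : w_generates Delta SC.
Proof.
move=> n _ D D'; apply: w_related_one_move => {D D'} E E'.
case=> a [[k [ht hh]] [es eg]].
have [l [w [r [da sk]]]] : exists l w r da, strand E k = l ++ (a, da) :: w ++ (a, ~~ da) :: r.
  move: ht hh.
  case/splitPr => l r; rewrite mem_cat inE xpair_eqE andbF /= => /orP [].
    case/splitPr => l1 l2; exists l1, l2, r, true; by rewrite -catA.
  case/splitPr => l1 l2; exists l, l1, l2, false; by [].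
apply: w_equiv_trans (w_equiv_flip_loop (u := [::]) (sgn E) (ltnSn _) (wf_diagram E) isT sk) _.
have w1 := wf_flip [:: a] (wf_diagram E).
apply: w_equiv_ext => // c; rewrite ends_relabel => /mapP [[e t] he [-> _]].
rewrite eg //; exact: (@arrowsP _ E (e, t)).
Qed.

Theorem theorem2p10 :
  [/\ w_generates CC BP, w_generates BP Delta & w_generates Delta SC].
Proof.
split; [exact: CC_generates_BP|exact: BP_generates_Delta|exact: Delta_generates_SC].
Qed.
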